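(* Let $U$ be a finite universe, let $z,k\ge 1$ be integers with $|U|=zk$, let $S_1,\dots,S_z\subseteq U$ with $|S_i|\le k$ for all $i$, and let $0<\varepsilon<1$. One can deterministically construct an $(\{S_i\},(1-\varepsilon)w)$-superimposed code of weight $w=\mathcal{O}(\varepsilon^{-1}\log^2|U|)$ and length $\ell=\mathcal{O}(\varepsilon^{-2}k\log^5|U|)$ in $\mathcal{O}(\varepsilon^{-1}|U|\log^2|U|)$ time and space.
   Context: Let $S_1,\dots,S_z$ be subsets of a universe $U$. A family of sets $\mathcal{C}=\{C_u: u\in U\}$ with $C_u\subseteq[\ell]=\{1,\dots,\ell\}$ and $|C_u|=w$ for all $u\in U$ is called an $(\{S_i\},\tau)$-superimposed code if for every $i$ and every $u\notin S_i$ we have $|C_u\setminus\bigcup_{v\in S_i}C_v|\ge\tau$. The numbers $\ell$ and $w$ are the length and the weight of the code. Computation is in the word RAM model; logarithms are base 2. *)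

(* Defs.v *)
From HB Require Import structures.
From mathcomp Require Import all_boot all_order all_algebra.
From mathcomp Require Import reals exp.

Set Implicit Arguments.
Unset Strict Implicit.
Unset Printing Implicit Defensive.

Import Order.TTheory GRing.Theory Num.Theory.

(** * Superimposed codes *)

(* [ell] is represented by 'I_ell, i.e. numbered from 0. *)
Definition superimposed_code (R : numDomainType) (U : finType) (z : nat)
    (S : 'I_z -> {set U}) (tau : R) (w ell : nat) (C : U -> {set 'I_ell}) : Prop :=
  (forall u, #|C u| = w) /\
  (forall i u, u \notin S i ->
     (tau <= #|C u :\: \bigcup_(v in S i) C v|%:R)%R).

(* Base-2 logarithm. Its argument is clipped at 2, so that expressions of the
   form O(log^a n) are also meaningful when n = 1. *)
Definition lg (R : realType) (n : nat) : R := (ln (maxn 2 n)%:R / ln 2)%R.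

(** * The word RAM *)

Definition reg := nat.

Inductive binop : Type :=
  | Add | Sub | Mul | Div | Mod | And | Or | Xor | Shl | Shr | Eq | Lt.

Inductive instr : Type :=
  | Const of reg & nat           (* rd := c *)
  | Op of binop & reg & reg & reg (* rd := ra o rb *)
  | Read of reg & reg            (* rd := mem[ra] *)
  | Write of reg & reg           (* mem[ra] := rb *)
  | Jump of nat                  (* goto t *)
  | JumpZ of reg & nat.          (* if ra = 0 then goto t *)

Definition program := seq instr.

Record config : Type := Config {
  pc : nat;
  regs : reg -> nat;
  mem : nat -> nat
}.

Definition upd (f : nat -> nat) (a v : nat) : nat -> nat :=
  fun b => if b == a then v else f b.

(* Every result is reduced modulo 2 ^ W, where W is the word length. Division
   and remainder by zero return 0 and the dividend. *)
Definition eval_op (W : nat) (o : binop) (x y : nat) : nat :=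
  (match o with
   | Add => x + y
   | Sub => x + (2 ^ W - y)
   | Mul => x * y
   | Div => x %/ y
   | Mod => x %% y
   | And => Nat.land x y
   | Or => Nat.lor x y
   | Xor => Nat.lxor x y
   | Shl => x * 2 ^ y
   | Shr => x %/ 2 ^ y
   | Eq => (x == y : nat)
   | Lt => (x < y : nat)
   end) %% 2 ^ W.

Definition exec (W : nat) (ins : instr) (c : config) : config :=
  let: Config p r m := c in
  match ins with
  | Const d n => Config p.+1 (upd r d (n %% 2 ^ W)) m
  | Op o d a b => Config p.+1 (upd r d (eval_op W o (r a) (r b))) m
  | Read d a => Config p.+1 (upd r d (m (r a))) m
  | Write a b => Config p.+1 r (upd m (r a) (r b))
  | Jump t => Config t r m
  | JumpZ a t => Config (if r a == 0 then t else p.+1) r m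
  end.

(* A configuration is halting when its program counter lies outside the
   program; such configurations are fixed by [step]. *)
Definition halted (P : program) (c : config) : bool := size P <= pc c.

Definition step (W : nat) (P : program) (c : config) : config :=
  if onth P (pc c) is Some ins then exec W ins c else c.

Definition accessed (P : program) (c : config) : option nat :=
  match onth P (pc c) with
  | Some (Read _ a) => Some (regs c a)
  | Some (Write a _) => Some (regs c a)
  | _ => None
  end.

Definition init (input : seq nat) : config :=
  Config 0 (fun _ => 0) (fun a => nth 0 input a).

(* P, started on [input], halts in configuration [c] after at most T unit-cost
   instructions; the input and all the memory cells it accesses lie among the
   first M memory cells. *)
Definition runs_within (W : nat) (P : program) (input : seq nat) (T M : nat)
    (c : config) : Prop :=
  [/\ iter T (step W P) (init input) = c,
      halted P c,
      size input <= M &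
      forall t a, t < T ->
        accessed P (iter t (step W P) (init input)) = Some a -> a < M].

(** * Input and output formats *)

(* The element u of U is represented by the word [enum_rank u] < #|U|, the
   family of sets by their sizes followed by the concatenation of lists of
   their elements, and the real parameter eps by the word e = ceil (1 / eps). *)
Definition encode_input (U : finType) (z k e : nat) (L : 'I_z -> seq U) : seq nat :=
  [:: z; k; e]
  ++ [seq size (L i) | i <- enum 'I_z]
  ++ flatten [seq [seq val (enum_rank u) | u <- L i] | i <- enum 'I_z].

Definition inv_ceil (R : realType) (eps : R) : nat := `|Num.ceil (eps^-1)%R|%N.

(* The length, the weight and the base address A of a #|U| x w array are in
   registers 0, 1, 2; the row of u lists the elements of C u. The array lies
   among the first M memory cells. *)
Definition outputs_code (U : finType) (c : config) (M w ell : nat)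
    (C : U -> {set 'I_ell}) : Prop :=
  [/\ regs c 0 = ell, regs c 1 = w, regs c 2 + #|U| * w <= M &
      forall u : U,
        perm_eq (mkseq (fun j => mem c (regs c 2 + enum_rank u * w + j)) w)
                [seq val x | x in C u]].

(* Main.v *)
(* Idea of the construction. Put U = {0, ..., n-1}, n = zk, L = floor(log n) + 1, e = ceil(1/eps)
   and w = e L (L + 3).

   (1) The elements are distributed greedily over kp buckets, kp being the power of 2 in [2k, 4k).
   If s_i elements of S_i have been placed, load_(i,b) of them into bucket b, then the potential
   sum_i (2k - s_i) sum_b 2^load_(i,b) can be kept from increasing: an average bucket multiplies
   the inner sum by at most 1 + 1/kp, which the decrease of 2k - s_i outweighs because kp >= 2k.
   Hence 2^load_(i,b) <= 2 z kp < 8n at the end, that is, load_(i,b) < L + 3. All weights are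
   integers, and a good bucket is found in log kp steps by descending, always into the lighter
   child, a binary tree of partial sums that is kept for each set.

   (2) Take for the moduli p_0, ..., p_(w-1) the first w numbers that are prime or at least n. By
   Erdos' estimate of the central binomial coefficient they are O(e L^3), and two distinct elements
   are congruent modulo fewer than L of them.

   (3) C_u consists of the codes of the triples (bucket of u, j, u mod p_j) with j < w. For u not
   in S_i, a triple of u can only be hit by one of the fewer than L + 3 elements of S_i in the
   bucket of u, each of which hits fewer than L triples; so fewer than L (L + 3) <= eps w triples
   are hit.

   The RAM program is the compilation of a program in a small structured language, about which one
   reasons by means of weakest preconditions whose postconditions track the remaining time. *)

Require Import Defs.
From HB Require Import structures.
From mathcomp Require Import all_boot all_order all_algebra.
From mathcomp Require Import reals exp.
From mathcomp Require Import zify lra.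

Set Implicit Arguments.
Unset Strict Implicit.
Unset Printing Implicit Defensive.

Import Order.TTheory GRing.Theory Num.Theory.

(** * A structured language compiled to the word RAM *)

Inductive expr : Type :=
  | Cst of nat
  | Var of reg
  | Bin of binop & expr & expr
  | Ld of expr.

Inductive cmd : Type :=
  | Skip
  | Asg of reg & expr
  | Sto of expr & expr
  | Seq of cmd & cmd
  | If of expr & cmd & cmd
  | While of expr & cmd.

(* Registers from [nvars] on hold the intermediate values of expressions. *)
Definition nvars := 40.

(* Code evaluating an expression with scratch registers from [d] on, and the
   register in which the value is found. *)
Fixpoint compile_expr (d : reg) (x : expr) : seq instr * reg :=
  match x with
  | Cst c => ([:: Const d c], d)
  | Var y => ([::], y)
  | Bin o x1 x2 =>
    let: (c1, r1) := compile_expr d x1 in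
    let: (c2, r2) := compile_expr d.+1 x2 in
    (c1 ++ c2 ++ [:: Op o d r1 r2], d)
  | Ld x1 => let: (c1, r1) := compile_expr d x1 in (rcons c1 (Read d r1), d)
  end.

Definition ecode x := (compile_expr nvars x).1.
Definition eres x := (compile_expr nvars x).2.
Definition ecost x := size (ecode x).

Fixpoint csize (c : cmd) : nat :=
  match c with
  | Skip => 0
  | Asg _ x => (ecost x).+2
  | Sto x y => (ecost x + size (compile_expr nvars.+1 y).1).+1
  | Seq c1 c2 => csize c1 + csize c2
  | If x c1 c2 => ecost x + (csize c1 + (csize c2).+2)
  | While x c1 => ecost x + (csize c1).+2
  end.

Fixpoint compile (p : nat) (c : cmd) : seq instr :=
  match c with
  | Skip => [::]
  | Asg r x => ecode x ++ [:: Const nvars.+1 0; Op Add r (eres x) nvars.+1]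
  | Sto x y => ecode x ++ (compile_expr nvars.+1 y).1 ++
      [:: Write (eres x) (compile_expr nvars.+1 y).2]
  | Seq c1 c2 => compile p c1 ++ compile (p + csize c1) c2
  | If x c1 c2 =>
      ecode x ++ JumpZ (eres x) (p + (ecost x + (csize c1).+2)) ::
      compile (p + (ecost x).+1) c1 ++
      Jump (p + csize c) :: compile (p + (ecost x + (csize c1).+2)) c2
  | While x c1 =>
      ecode x ++ JumpZ (eres x) (p + csize c) ::
      compile (p + (ecost x).+1) c1 ++ [:: Jump p]
  end.

Lemma size_compile p c : size (compile p c) = csize c.
Proof.
elim: c p => [|r x|x y|c1 IH1 c2 IH2|x c1 IH1 c2 IH2|x c1 IH1] p //=;
  rewrite ?size_cat /= ?size_cat /= ?IH1 ?IH2 /ecost; lia.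
Qed.

Definition state : Type := (nat -> nat) * (nat -> nat).

Definition setv (v : nat -> nat) (x a : nat) : nat -> nat :=
  fun y => if y == x then a else v y.

Definition ideal_op (o : binop) (x y : nat) : nat :=
  match o with
  | Add => x + y
  | Defs.Sub => x - y
  | Mul => x * y
  | Div => x %/ y
  | Mod => x %% y
  | Eq => x == y
  | Lt => x < y
  | _ => 0
  end.

Fixpoint eval (s : state) (x : expr) : nat :=
  match x with
  | Cst c => c
  | Var y => s.1 y
  | Bin o x1 x2 => ideal_op o (eval s x1) (eval s x2)
  | Ld x1 => s.2 (eval s x1)
  end.

Definition wsize W := 2 ^ W.

Section Semantics.

Variables (W M : nat).

Definition op_safe (o : binop) (x y : nat) : Prop :=
  match o with
  | Defs.Sub => (y <= x) && (x < wsize W)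
  | And | Or | Xor | Shl | Shr => False
  | _ => ideal_op o x y < wsize W
  end.

Fixpoint safe (s : state) (x : expr) : Prop :=
  match x with
  | Cst c => c < wsize W
  | Var y => y < nvars
  | Bin o x1 x2 => [/\ safe s x1, safe s x2 & op_safe o (eval s x1) (eval s x2)]
  | Ld x1 => safe s x1 /\ eval s x1 < M
  end.

Lemma eval_op_ideal o x y : op_safe o x y -> eval_op W o x y = ideal_op o x y.
Proof.
rewrite /eval_op; case: o => //= h; try exact: modn_small.
case/andP: h => lyx lx; have ly := leq_ltn_trans lyx lx.
rewrite addnBA ?(ltnW ly) // -addnBAC // modnDr modn_small //.
exact: leq_ltn_trans (leq_subr _ _) lx.
Qed.

Variable P : program.

Definition placed (p : nat) (code : seq instr) : Prop :=
  forall i, i < size code -> onth P (p + i) = onth code i.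

Lemma placed_cat p c1 c2 :
  placed p (c1 ++ c2) -> placed p c1 /\ placed (p + size c1) c2.
Proof.
move=> h; split=> i li.
  by rewrite h ?size_cat ?ltn_addr // onth_cat li.
rewrite -addnA h ?size_cat ?ltn_add2l // onth_cat.
by rewrite ltnNge leq_addr /= addnC addnK.
Qed.

Lemma placed_cons p i c : placed p (i :: c) -> onth P p = Some i /\ placed p.+1 c.
Proof.
rewrite -cat1s => /placed_cat[h1 h2]; split; last by rewrite addn1 in h2.
by have := h1 0 isT; rewrite addn0.
Qed.

Definition runs (c : config) (t : nat) (c' : config) : Prop :=
  iter t (step W P) c = c' /\
  forall t' a, t' < t -> accessed P (iter t' (step W P) c) = Some a -> a < M.

Lemma runs0 c : runs c 0 c.
Proof. by []. Qed.

Lemma runs_trans c1 c2 c3 t1 t2 :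
  runs c1 t1 c2 -> runs c2 t2 c3 -> runs c1 (t1 + t2) c3.
Proof.
move=> [e1 h1] [e2 h2]; split; first by rewrite addnC iterD e1.
move=> t a; case: (ltnP t t1) => [lt _|let1]; first exact: h1.
by rewrite -{1 2}(subnK let1) iterD e1 addnC ltn_add2l; apply: h2.
Qed.

Lemma runs_snoc c1 c2 c3 t : runs c1 t c2 -> runs c2 1 c3 -> runs c1 t.+1 c3.
Proof. by move=> h1 h2; rewrite -addn1; apply: runs_trans h1 h2. Qed.

Lemma runs1 p r m ins : onth P p = Some ins ->
  (forall a, accessed P (Config p r m) = Some a -> a < M) ->
  runs (Config p r m) 1 (exec W ins (Config p r m)).
Proof.
move=> h ha; split; first by rewrite /= /step /= h.
by case=> // a _ /ha.
Qed.

Definition agree (v r : nat -> nat) : Prop := forall y, y < nvars -> r y = v y.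

Lemma agree_upd v r d a : nvars <= d -> agree v r -> agree v (upd r d a).
Proof. by move=> ld h y ly; rewrite /upd ltn_eqF ?h // (leq_trans ly). Qed.

Lemma runs_expr v m x d p r :
  nvars <= d -> placed p (compile_expr d x).1 -> agree v r -> safe (v, m) x ->
  exists r', [/\ runs (Config p r m) (size (compile_expr d x).1)
                   (Config (p + size (compile_expr d x).1) r' m),
     agree v r', r' (compile_expr d x).2 = eval (v, m) x,
     forall y, y < d -> r' y = r y &
     (compile_expr d x).2 < d.+1].
Proof.
elim: x d p r => [c|y|o x1 IH1 x2 IH2|x1 IH1] d p r ld /=.
- move=> /placed_cons[hp _] hv hs; exists (upd r d c).
  split=> //; last 1 first.
  + by move=> y ly; rewrite /upd ltn_eqF.
  + have := runs1 (r := r) (m := m) hp.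
    by rewrite /accessed /= hp modn_small // addn1; apply.
  + exact: agree_upd.
  + by rewrite /upd eqxx.
- move=> _ hv hs; exists r; rewrite addn0; split=> //; first exact: hv.
  exact: ltnW (leq_trans hs ld).
- case E1: (compile_expr d x1) => [c1 r1].
  case E2: (compile_expr d.+1 x2) => [c2 r2] /=.
  move=> /placed_cat[hp1 /placed_cat[hp2 /placed_cons[hp3 _]]] hv [hs1 hs2 ho].
  have := IH1 d p r ld; rewrite E1 /= => /(_ hp1 hv hs1)[r' [run1 hv1 er1 fr1 l1]].
  have := IH2 d.+1 (p + size c1) r' (leqW ld).
  rewrite E2 /= => /(_ hp2 hv1 hs2)[r'' [run2 hv2 er2 fr2 l2]].
  exists (upd r'' d (eval_op W o (r'' r1) (r'' r2))); split.
  + rewrite !size_cat /= addn1 !addnS addnA.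
    apply: (runs_snoc (runs_trans run1 run2)).
    apply: (runs1 (ins := Op o d r1 r2) hp3).
    by rewrite /accessed /= hp3.
  + exact: agree_upd.
  + by rewrite /upd eqxx fr2 // er1 er2 eval_op_ideal.
  + move=> y ly; rewrite /upd ltn_eqF // fr2 ?fr1 //; exact: leqW.
  + by [].
- case E1: (compile_expr d x1) => [c1 r1] /=.
  rewrite -cats1; move=> /placed_cat[hp1 /placed_cons[hp2 _]] hv [hs1 ha].
  have := IH1 d p r ld; rewrite E1 /= => /(_ hp1 hv hs1)[r' [run1 hv1 er1 fr1 l1]].
  exists (upd r' d (m (r' r1))); split.
  + rewrite size_cat /= addn1 addnS.
    apply: (runs_snoc run1).
    apply: (runs1 (ins := Read d r1) hp2).
    by rewrite /accessed /= hp2 => a [<-]; rewrite er1.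
  + exact: agree_upd.
  + by rewrite /upd eqxx er1.
  + by move=> y ly; rewrite /upd ltn_eqF ?fr1.
  + by [].
Qed.

End Semantics.

(* Total correctness with fuel: [T] steps are available, and [Q] receives the
   number of steps that are left. *)
Definition wp W M (c : cmd) (s : state) (T : nat) (Q : state -> nat -> Prop) : Prop :=
  forall P p r, placed P p (compile p c) -> agree s.1 r ->
  exists t T' r' s', [/\ t + T' <= T,
    runs W M P (Config p r s.2) t (Config (p + csize c) r' s'.2),
    agree s'.1 r' & Q s' T'].

Section Rules.

Variables (W M : nat).
Implicit Types (c : cmd) (s : state) (T : nat) (Q : state -> nat -> Prop).

Lemma wp_skip s T Q : Q s T -> wp W M Skip s T Q.
Proof.
move=> h P p r _ hr; exists 0, T, r, s; rewrite addn0; split=> //; exact: runs0.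
Qed.

Lemma wp_asg x e s T Q : x < nvars -> safe W M s e -> eval s e < wsize W ->
  (ecost e).+2 <= T -> Q (setv s.1 x (eval s e), s.2) (T - (ecost e).+2) ->
  wp W M (Asg x e) s T Q.
Proof.
case: s => v m /= lx hs he hT hQ P p r /= /placed_cat[hp1].
move=> /placed_cons[hp2 /placed_cons[hp3 _]] hr.
have [r' [run1 hv1 er1 fr1 l1]] := runs_expr (leqnn _) hp1 hr hs.
exists (ecost e).+2, (T - (ecost e).+2).
exists (upd (upd r' nvars.+1 (0 %% 2 ^ W)) x (eval (v, m) e)).
exists (setv v x (eval (v, m) e), m); rewrite subnKC //; split=> //.
- have h := runs1 W (M := M) (r := r') (m := m) hp2.
  apply: (runs_snoc (runs_snoc run1 (h _))); first by rewrite /accessed /= hp2.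
  have h' := runs1 W (M := M) (r := upd r' nvars.+1 (0 %% 2 ^ W)) (m := m) hp3.
  have := h' (fun a => _); rewrite /= /upd eqxx.
  rewrite (_ : (eres e == nvars.+1) = false); last by apply: ltn_eqF.
  rewrite er1 mod0n /= eval_op_ideal /= addn0 // => h2.
  rewrite !addnS; apply: h2.
  by rewrite /accessed [pc _]/= hp3.
- move=> y ly; rewrite /upd /setv /=; case: eqP => // _.
  by rewrite ltn_eqF ?hv1 // (leq_trans ly).
Qed.

Lemma wp_sto x e s T Q : safe W M s x -> safe W M s e -> eval s x < M ->
  csize (Sto x e) <= T -> Q (s.1, upd s.2 (eval s x) (eval s e)) (T - csize (Sto x e)) ->
  wp W M (Sto x e) s T Q.
Proof.
case: s => v m hs1 hs2 ha hT hQ P p r.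
rewrite [compile _ _]/=; move=> /placed_cat[hp1] /placed_cat[hp2] /placed_cons[hp3 _] hr.
have [r1 [run1 hv1 er1 fr1 l1]] := runs_expr (leqnn _) hp1 hr hs1.
have [r2 [run2 hv2 er2 fr2 l2]] := runs_expr (leqnSn _) hp2 hv1 hs2.
exists (csize (Sto x e)), (T - csize (Sto x e)), r2; eexists; split; last exact: hQ.
- by rewrite subnKC.
- rewrite /csize; apply: (runs_snoc (runs_trans run1 run2)).
  rewrite /= addnS addnA.
  have := runs1 W (M := M) (r := r2) (m := m) hp3.
  rewrite /= er2 fr2 // er1 => h; apply: h.
  by rewrite /accessed /= hp3 /= fr2 // er1 => a [<-].
- by [].
Qed.

Lemma wp_seq c1 c2 s T Q :
  wp W M c1 s T (fun s' T' => wp W M c2 s' T' Q) -> wp W M (Seq c1 c2) s T Q.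
Proof.
move=> h P p r /= /placed_cat[hp1]; rewrite size_compile => hp2 hr.
have [t1 [T1 [r1 [s1 [le1 run1 hr1 h1]]]]] := h P p r hp1 hr.
have [t2 [T2 [r2 [s2 [le2 run2 hr2 h2]]]]] := h1 P _ r1 hp2 hr1.
exists (t1 + t2), T2, r2, s2; split=> //; first lia.
by rewrite addnA; apply: runs_trans run1 run2.
Qed.

Lemma wp_if x c1 c2 s T Q : safe W M s x -> (ecost x).+2 <= T ->
  (eval s x <> 0 -> wp W M c1 s (T - (ecost x).+2) Q) ->
  (eval s x = 0 -> wp W M c2 s (T - (ecost x).+2) Q) ->
  wp W M (If x c1 c2) s T Q.
Proof.
case: s => v m hs hT h1 h2 P p r.
rewrite [compile _ _]/=; move=> /placed_cat[hp1] /placed_cons[hp2].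
move=> /placed_cat[hp3] /placed_cons[hp4 hp5] hr.
have [r1 [run1 hv1 er1 fr1 l1]] := runs_expr (leqnn _) hp1 hr hs.
have run2 := runs1 W (M := M) (r := r1) (m := m) hp2.
have {}run2 := run2 (fun a => _).
move: run2; rewrite /accessed /= hp2 er1 => run2.
have {}run2 := run2 (fun _ H => match H with end).
rewrite !size_compile -/(ecost _) -?addnS in hp3 hp4 hp5.
case: eqP run2 => he run2.
  have [|t [T' [r' [s' [le run hr' hQ]]]]] := h2 he P (p + (ecost x + (csize c1).+2)) r1 _ hv1.
    by move: hp5; congr placed; lia.
  exists ((ecost x).+1 + t), T', r', s'; split=> //; first lia.
  apply: (runs_trans (runs_snoc run1 run2)).
  by move: run; congr (runs _ _ _ _ _ (Config _ _ _)); rewrite /=; lia.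
have [|t [T' [r' [s' [le run hr' hQ]]]]] := h1 he P (p + (ecost x).+1) r1 _ hv1.
  by [].
exists (((ecost x).+1 + t).+1), T', r', s'; split=> //; first lia.
have := runs1 W (M := M) (r := r') (m := s'.2) hp4.
rewrite /= /accessed /= hp4 => /(_ (fun _ H => match H with end)) run4.
apply: runs_snoc run4; apply: (runs_trans (runs_snoc run1 run2)).
by move: run; rewrite -/(ecost _); congr (runs _ _ _ (Config _ _ _) _ _); rewrite ?addnS.
Qed.

Lemma wp_while x c (I : state -> nat -> Prop) Q s T :
  (forall s T, I s T -> [/\ safe W M s x, (ecost x).+2 <= T,
     eval s x <> 0 -> wp W M c s (T - (ecost x).+2) I &
     eval s x = 0 -> Q s (T - (ecost x).+2)]) ->
  I s T -> wp W M (While x c) s T Q.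
Proof.
move=> h; have [N] := ubnP T; elim: N s T => // N IH [v m] T leT hI P p r hp hr.
have [hs hT h1 h2] := h _ _ hI.
move: (hp); rewrite [compile _ _]/=; move=> /placed_cat[hp1] /placed_cons[hp2].
move=> /placed_cat[hp3] /placed_cons[hp4 _].
have [r1 [run1 hv1 er1 fr1 l1]] := runs_expr (leqnn _) hp1 hr hs.
have run2 := runs1 W (M := M) (r := r1) (m := m) hp2.
have {}run2 := run2 (fun a => _).
move: run2; rewrite /accessed /= hp2 er1 => run2.
have {}run2 := run2 (fun _ H => match H with end).
rewrite !size_compile -/(ecost _) -?addnS in hp3 hp4.
case: eqP run2 => he run2.
  exists (ecost x).+1, (T - (ecost x).+2), r1, (v, m); split=> //; first lia.
  - exact: runs_snoc run1 run2.
  - exact: h2.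
have [t [T1 [r' [s' [le run hr' hQ]]]]] := h1 he P (p + (ecost x).+1) r1 hp3 hv1.
have leN : T1 < N by lia.
have [t2 [T2 [r2 [s2 [le2 runw hr2 hQ2]]]]] := IH s' T1 leN hQ P p r' hp hr'.
exists (((ecost x).+1 + t).+1 + t2), T2, r2, s2; split=> //; first lia.
have := runs1 W (M := M) (r := r') (m := s'.2) hp4.
rewrite /= /accessed /= hp4 => /(_ (fun _ H => match H with end)) run4.
apply: runs_trans runw; apply: runs_snoc run4.
apply: (runs_trans (runs_snoc run1 run2)).
by move: run; rewrite -/(ecost _); congr (runs _ _ _ (Config _ _ _) _ _); rewrite ?addnS.
Qed.

End Rules.

(** * Balanced buckets *)

Section Balance.

Variables (z k kp : nat) (l : nat -> seq nat).
Implicit Types g : nat -> nat.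

Definition load g i u b := count (fun v => (v < u) && (g v == b)) (l i).
Definition seen i u := count (fun v => v < u) (l i).
Definition adj u := [seq i <- index_iota 0 z | u \in l i].
Definition mass g i u := \sum_(0 <= b < kp) 2 ^ load g i u b.
Definition pot g u := \sum_(0 <= i < z) (2 * k - seen i u) * mass g i u.

Hypothesis l_uniq : forall i, i < z -> uniq (l i).
Hypothesis l_size : forall i, i < z -> size (l i) <= k.

Lemma count_ltS (a : pred nat) s u : uniq s ->
  count (fun v => (v < u.+1) && a v) s =
  count (fun v => (v < u) && a v) s + (a u && (u \in s)).
Proof.
elim: s => [|x s IH] /=; first by rewrite andbF.
case/andP=> xs us; rewrite IH // inE ltnS leq_eqVlt.
case: eqP => [e|/eqP nxu] /=.
  by rewrite e eqxx ltnn (negbTE (_ : u \notin s)) ?e //; [case: (a u); lia | rewrite -e].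
by rewrite eq_sym (negbTE nxu) /=; lia.
Qed.

Lemma load_step g i u b : i < z ->
  load g i u.+1 b = load g i u b + ((g u == b) && (u \in l i)).
Proof. by move=> iz; rewrite /load (count_ltS (fun v => g v == b)) ?l_uniq. Qed.

Lemma seen_step i u : i < z -> seen i u.+1 = seen i u + (u \in l i).
Proof.
move=> iz; have := count_ltS xpredT u (l_uniq iz).
have e w : count (fun v => (v < w) && true) (l i) = seen i w.
  by apply: eq_count => v; rewrite andbT.
by rewrite !e.
Qed.

Lemma seen_lt i u : i < z -> u \in l i -> seen i u < k.
Proof.
move=> iz ul; apply: leq_trans (l_size iz).
by rewrite -(count_predC (fun v => v < u)) -addn1 leq_add2l -has_count;
  apply/hasP; exists u => //=; rewrite ltnn.
Qed.

Lemma seen_le i u : i < z -> seen i u <= k.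
Proof. by move=> iz; apply: leq_trans (count_size _ _) (l_size iz). Qed.

Lemma mass_step g i u : i < z -> g u < kp ->
  mass g i u.+1 = mass g i u + (u \in l i) * 2 ^ load g i u (g u).
Proof.
move=> iz gu; rewrite /mass.
have gin : g u \in index_iota 0 kp by rewrite mem_index_iota.
rewrite !(bigD1_seq (g u) gin (iota_uniq _ _)) /= load_step // eqxx /=.
under eq_bigr => b /negbTE nb do rewrite load_step // eq_sym nb addn0.
by case: (u \in l i); rewrite ?addn1 ?addn0 ?expnS ?mul1n; lia.
Qed.

Lemma pot_step g u : 2 * k <= kp -> 0 < kp -> g u < kp ->
  kp * (\sum_(i <- adj u) (2 * k - (seen i u).+1) * 2 ^ load g i u (g u)) <=
  \sum_(i <- adj u) (2 * k - (seen i u).+1) * mass g i u ->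
  pot g u.+1 <= pot g u.
Proof.
move=> kkp kp0 gu; rewrite /adj !big_filter => h.
rewrite /pot (bigID (fun i => u \in l i)) /= [leqRHS](bigID (fun i => u \in l i)) /=.
apply: leq_add; last first.
  rewrite big_nat_cond [leqRHS]big_nat_cond; apply: leq_sum => i /andP[/andP[_ iz] /negbTE nu].
  by rewrite seen_step // mass_step // nu addn0 mul0n addn0.
set SI := \sum_(_ <- _ | _) _ * 2 ^ _ in h.
set SA := \sum_(_ <- _ | _) _ in h.
pose S1 := \sum_(0 <= i < z | u \in l i) mass g i u.
have -> : \sum_(0 <= i < z | u \in l i) (2 * k - seen i u.+1) * mass g i u.+1 = SA + SI.
  rewrite -big_split /= big_nat_cond [RHS]big_nat_cond.
  apply: eq_bigr => i /andP[/andP[_ iz] ui].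
  by rewrite seen_step // mass_step // ui mul1n addn1 mulnDr.
have -> : \sum_(0 <= i < z | u \in l i) (2 * k - seen i u) * mass g i u = SA + S1.
  rewrite -big_split /= big_nat_cond [RHS]big_nat_cond.
  apply: eq_bigr => i /andP[/andP[_ iz] ui].
  have := seen_lt iz ui => lts.
  have -> : 2 * k - seen i u = (2 * k - (seen i u).+1).+1 by lia.
  by rewrite mulSn addnC.
rewrite leq_add2l -(leq_pmul2l kp0); apply: leq_trans h _.
rewrite big_distrr /=; apply: leq_sum => i _; rewrite leq_mul2r.
by apply/orP; right; lia.
Qed.

Lemma pot0 g : pot g 0 = z * (2 * k * kp).
Proof.
rewrite /pot (eq_bigr (fun=> 2 * k * kp)) ?big_const_nat ?iter_addn_0 ?subn0 1?mulnC //.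
move=> i _; rewrite /seen (eq_count (a2 := xpred0)) // count_pred0 subn0; congr (_ * _).
rewrite /mass (eq_bigr (fun=> 1)) ?big_const_nat ?iter_addn_0 ?subn0 ?mul1n //.
by move=> b _; rewrite /load (eq_count (a2 := xpred0)) // count_pred0.
Qed.

Lemma mass_pot g i u : i < z -> (2 * k - seen i u) * mass g i u <= pot g u.
Proof.
move=> iz; have iin : i \in index_iota 0 z by rewrite mem_index_iota.
by rewrite /pot (bigD1_seq i iin (iota_uniq _ _)) /= leq_addr.
Qed.

Lemma sum_adj_pot g u : \sum_(i <- adj u) (2 * k - seen i u) * mass g i u <= pot g u.
Proof. by rewrite big_filter /pot [leqRHS](bigID (fun i => u \in l i)) /= leq_addr. Qed.

Lemma load_mass g i u b : b < kp -> 2 ^ load g i u b <= mass g i u.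
Proof.
move=> bk; have bin : b \in index_iota 0 kp by rewrite mem_index_iota.
by rewrite /mass (bigD1_seq b bin (iota_uniq _ _)) /= leq_addr.
Qed.

Lemma load_ext g g' i u b : (forall v, v < u -> g v = g' v) ->
  load g i u b = load g' i u b.
Proof. by move=> h; apply: eq_count => v /=; case: ltnP => //= /h ->. Qed.

Lemma mass_ext g g' i u : (forall v, v < u -> g v = g' v) -> mass g i u = mass g' i u.
Proof. by move=> h; apply: eq_bigr => b _; rewrite (load_ext _ _ h). Qed.

Lemma pot_ext g g' u : (forall v, v < u -> g v = g' v) -> pot g u = pot g' u.
Proof. by move=> h; apply: eq_bigr => i _; rewrite (mass_ext _ h). Qed.

(* The load of a bucket enters [pot] as a power of 2 with weight at least [k]. *)
Lemma load_bound g i u b : 0 < k -> i < z -> b < kp -> pot g u <= z * (2 * k * kp) ->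
  2 ^ load g i u b <= 2 * z * kp.
Proof.
move=> k0 iz bk hp; rewrite -(leq_pmul2l k0).
apply: leq_trans (_ : pot g u <= _); last by apply: leq_trans hp _; lia.
apply: leq_trans (mass_pot g u iz); apply: leq_mul; last exact: load_mass.
by have := seen_le u iz; lia.
Qed.

Lemma adj_uniq u : uniq (adj u).
Proof. exact: filter_uniq (iota_uniq _ _). Qed.

Lemma mem_adj u i : (i \in adj u) = (i < z) && (u \in l i).
Proof. by rewrite mem_filter mem_index_iota andbC. Qed.

Lemma sum_size_adj n : (forall i u, i < z -> u \in l i -> u < n) ->
  \sum_(0 <= u < n) size (adj u) <= \sum_(0 <= i < z) size (l i).
Proof.
move=> ln; under eq_bigr => u _ do rewrite /adj size_filter -sum1_count big_mkcond.
rewrite exchange_big_nat /=.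
rewrite big_nat_cond [leqRHS]big_nat_cond; apply: leq_sum => i /andP[/andP[_ iz] _].
rewrite -big_mkcond sum1_count -size_filter uniq_leq_size //.
  exact: filter_uniq (iota_uniq _ _).
by move=> u; rewrite mem_filter => /andP[].
Qed.

End Balance.

(** * Moduli *)

Lemma leq_exp2rW m n e : m <= n -> m ^ e <= n ^ e.
Proof. by case: e => // e; rewrite leq_exp2r. Qed.

Lemma prime_dvdn_fact p n : prime p -> p %| n`! -> p <= n.
Proof.
move=> pp; elim: n => [|n IH]; first by rewrite dvdn1 => /eqP p1; rewrite p1 in pp.
rewrite factS Euclid_dvdM // => /orP[/dvdn_leq -> //|/IH]; exact: leqW.
Qed.

Lemma pfactor_central_binomial m p : 0 < m -> prime p ->
  p ^ logn p 'C(m.*2, m) <= m.*2.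
Proof.
move=> m0 pp; have p1 := prime_gt1 pp.
have bin : 'C(m.*2, m) * (m`! * m`!) = m.*2`!.
  by rewrite -(@bin_fact m.*2 m) -?addnn ?leq_addr // addnK.
have c0 : 0 < 'C(m.*2, m) by rewrite bin_gt0 -addnn leq_addr.
have := congr1 (logn p) bin; rewrite !lognM ?muln_gt0 ?fact_gt0 // !logn_fact // => e.
set t := trunc_log p m.*2.
have pt : p ^ t <= m.*2 by apply: trunc_logP => //; lia.
have pt1 : m.*2 < p ^ t.+1 by apply: trunc_log_ltn.
suff le : logn p 'C(m.*2, m) <= t by apply: leq_trans pt; rewrite leq_exp2l.
have tm : t < m.*2.+1 by rewrite ltnS; apply: leq_trans pt; apply: ltnW; apply: ltn_expl.
have z1 j : t < j -> m.*2 %/ p ^ j = 0.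
  by move=> tj; apply: divn_small; apply: leq_trans pt1 _; rewrite leq_exp2l.
have e2 : \sum_(1 <= j < m.*2.+1) m.*2 %/ p ^ j = \sum_(1 <= j < t.+1) m.*2 %/ p ^ j.
  rewrite (big_cat_nat (n := t.+1)) //= [X in _ + X]big_nat_cond [X in _ + X]big1 ?addn0 //.
  by move=> j /andP[/andP[tj _] _]; apply: z1.
have e3 : \sum_(1 <= j < t.+1) m %/ p ^ j <= \sum_(1 <= j < m.+1) m %/ p ^ j.
  have [le|lt] := leqP t m.
    by rewrite [leqRHS](big_cat_nat (n := t.+1)) //= leq_addr.
  rewrite (big_cat_nat (n := m.+1)) //=; last by rewrite ltnS ltnW.
  rewrite [X in _ + X]big_nat_cond [X in _ + X]big1 ?addn0 //.
  move=> j /andP[/andP[mj _] _]; apply: divn_small.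
  by apply: leq_trans mj _; apply: ltnW; apply: ltn_expl.
have e4 : \sum_(1 <= j < t.+1) m.*2 %/ p ^ j <=
    \sum_(1 <= j < t.+1) m %/ p ^ j + \sum_(1 <= j < t.+1) m %/ p ^ j + t.
  rewrite -[X in _ <= _ + X](_ : \sum_(1 <= j < t.+1) 1 = t); last first.
    by rewrite sum_nat_const_nat subn1 muln1.
  rewrite -!big_split /=; apply: leq_sum => j _; rewrite -addnn divnD ?expn_gt0 ?prime_gt0 //.
  by rewrite leq_add2l leq_b1.
lia.
Qed.

Lemma expn2_central_binomial m : 2 ^ m <= 'C(m.*2, m).
Proof.
elim: m => // m IH; rewrite doubleS binS expnS.
have e : 'C(m.*2.+1, m) = 'C(m.*2.+1, m.+1).
  by rewrite -[RHS]bin_sub; [congr binomial; lia | lia].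
have h : 2 ^ m <= 'C(m.*2.+1, m.+1) by rewrite binS (leq_trans IH) // leq_addl.
by rewrite e; lia.
Qed.

Lemma expn2_primes m : 0 < m -> 2 ^ m <= m.*2 ^ count prime (index_iota 2 m.*2.+1).
Proof.
move=> m0; apply: leq_trans (expn2_central_binomial m) _.
have c0 : 0 < 'C(m.*2, m) by rewrite bin_gt0 -addnn leq_addr.
rewrite {1}(prod_prime_decomp c0) prime_decompE big_map /=.
apply: (@leq_trans (\prod_(p <- primes 'C(m.*2, m)) m.*2)).
  rewrite !big_seq; apply: leq_prod => p.
  by rewrite mem_primes => /andP[pp _]; apply: pfactor_central_binomial.
rewrite big_const_seq count_predT iter_muln_1 leq_exp2l; last by lia.
rewrite -size_filter; apply: uniq_leq_size (primes_uniq _) _ => p.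
rewrite mem_primes mem_filter mem_index_iota => /and3P[pp _ pd].
rewrite pp prime_gt1 //= ltnS leqNgt; apply/negP => lt.
have : p %| m.*2`!.
  by rewrite -(@bin_fact m.*2 m) -?addnn ?leq_addr // dvdn_mulr // addnn.
by move/(prime_dvdn_fact pp); rewrite leqNgt lt.
Qed.

(* Moduli from [n] on separate all elements of the universe, prime or not. *)
Definition good_modulus n p := (n <= p) || prime p.

Lemma count_good_moduli n e L : 0 < e -> 0 < L -> n < 2 ^ L ->
  e * L * (L + 3) <= count (good_modulus n) (index_iota 2 (16 * e * L ^ 3).+1).
Proof.
move=> e0 L0 nL; pose X := 8 * e * L ^ 3.
have X0 : 0 < X by rewrite /X !muln_gt0 e0 L0.
have -> : 16 * e * L ^ 3 = X.*2 by rewrite /X; lia.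
have eL2 : e * L * (L + 3) * (2 * L) <= X.
  rewrite /X !expnS expn0; nia.
have wX : e * L * (L + 3) * 2 <= X.
  by apply: leq_trans eL2; rewrite leq_mul2l; apply/orP; right; lia.
have [le|lt] := leqP n X.
  apply: (@leq_trans X).
    by apply: leq_trans wX; rewrite leq_pmulr.
  have X2 : 2 <= X by apply: leq_trans wX; rewrite -{1}(mul1n 2) leq_mul2r /= !muln_gt0 e0 L0 addn3.
  have eX : count (good_modulus n) (index_iota X.+1 X.*2.+1) = X.
    rewrite (eq_in_count (a2 := xpredT)); last first.
      move=> p; rewrite mem_index_iota => /andP[Xp _].
      by rewrite /good_modulus (leq_trans le) // ltnW.
    by rewrite count_predT size_iota; lia.
  rewrite -{1}eX /index_iota [X.*2.+1 - 2](_ : _ = (X.+1 - 2) + (X.*2.+1 - X.+1)); last lia.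
  by rewrite iotaD count_cat [2 + _](_ : _ = X.+1) ?leq_addl //; lia.
have h := expn2_primes X0.
have lt2 : X.*2 <= 2 ^ L.+1 by rewrite expnS; lia.
have {}h : 2 ^ X <= 2 ^ (L.+1 * count prime (index_iota 2 X.*2.+1)).
  by rewrite expnM; apply: leq_trans h _; rewrite leq_exp2rW.
rewrite leq_exp2l // in h.
apply: (@leq_trans (count prime (index_iota 2 X.*2.+1))); last first.
  by apply: sub_count => p pp; rewrite /good_modulus pp orbT.
have L20 : 0 < 2 * L by lia.
rewrite -(leq_pmul2r L20); apply: leq_trans eL2 _; apply: leq_trans h _.
by rewrite mulnC leq_mul2l; apply/orP; right; lia.
Qed.

Lemma expn2_primes_le x : 0 < x -> 2 ^ size (primes x) <= x.
Proof.
move=> x0; rewrite {2}(prod_prime_decomp x0) prime_decompE big_map /=.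
rewrite -[2 ^ _]muln1 -iter_muln -[size _]count_predT -big_const_seq.
rewrite big_seq [leqRHS]big_seq; apply: leq_prod => p pin.
have := pin; rewrite mem_primes => /andP[pp _].
rewrite -(expn1 2) (leq_trans (leq_exp2rW _ (prime_gt1 pp))) //.
by rewrite leq_exp2l ?prime_gt1 // logn_gt0.
Qed.

Lemma collisions_lt n L (ps : seq nat) u v : uniq ps -> all (good_modulus n) ps ->
  0 < L -> n <= 2 ^ L -> u < n -> v < n -> u != v ->
  count (fun p => u %% p == v %% p) ps < L.
Proof.
move=> ups gps L0 nL; wlog: u v / v < u.
  move=> h un vn; rewrite neq_ltn => /orP[lt|lt]; last by apply: h => //; rewrite gtn_eqF.
  rewrite (eq_count (a2 := fun p => v %% p == u %% p)); last by move=> p; rewrite /= eq_sym.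
  by apply: h => //; rewrite gtn_eqF.
move=> vu un vn _; have x0 : 0 < u - v by rewrite subn_gt0.
rewrite -(ltn_exp2l (m := 2)) //; apply: leq_ltn_trans (leq_trans un nL).
apply: leq_ltn_trans (_ : u - v < u.+1); last by rewrite ltnS leq_subr.
apply: leq_trans (expn2_primes_le x0); rewrite leq_exp2l // -size_filter.
apply: uniq_leq_size (filter_uniq _ ups) _ => p.
rewrite mem_filter mem_primes x0 /= eqn_mod_dvd ?(ltnW vu) // => /andP[pd /(allP gps)].
rewrite pd andbT /good_modulus => /orP[np|//].
by have := dvdn_leq x0 pd; rewrite leqNgt (leq_trans _ np) //; lia.
Qed.

(** * The program *)

Declare Scope cmd_scope.
Declare Scope expr_scope.
Delimit Scope cmd_scope with cmd.
Delimit Scope expr_scope with expr.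
Bind Scope cmd_scope with cmd.
Bind Scope expr_scope with expr.
Notation "c1 ;; c2" := (Seq c1%cmd c2%cmd) (at level 90, right associativity) : cmd_scope.
Notation "x ::= e" := (Asg x e%expr) (at level 70) : cmd_scope.
Notation "put[ a , e ]" := (Sto a%expr e%expr) : cmd_scope.
Notation "get[ a ]" := (Ld a%expr) : expr_scope.
Notation "$ x" := (Var x) (at level 5, format "$ x") : expr_scope.
Coercion Cst : nat >-> expr.
Notation "a + b" := (Bin Add a b) : expr_scope.
Notation "a - b" := (Bin Defs.Sub a b) : expr_scope.
Notation "a * b" := (Bin Mul a b) : expr_scope.
Notation "a / b" := (Bin Div a b) : expr_scope.
Notation "a 'mod' b" := (Bin Mod a b) (at level 40) : expr_scope.
Notation "a < b" := (Bin Lt a b) : expr_scope.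

(* Registers 0, 1, 2 are imposed by the output format, and registers 3 to 13
   are constant after the prologue. *)
Notation vell := 0 (only parsing).
Notation vw := 1 (only parsing).
Notation vA := 2 (only parsing).
Notation vz := 3 (only parsing).
Notation vk := 4 (only parsing).
Notation ve := 5 (only parsing).
Notation vn := 6 (only parsing).
Notation vL := 7 (only parsing).
Notation vt := 8 (only parsing).
Notation vkp := 9 (only parsing).
Notation vH := 10 (only parsing).
Notation vN := 11 (only parsing).
Notation vD := 12 (only parsing).
Notation vP := 13 (only parsing).
Notation vp := 14 (only parsing).
Notation vq := 15 (only parsing).
Notation vi := 16 (only parsing).
Notation vc := 17 (only parsing).
Notation vu := 18 (only parsing).
Notation vy := 19 (only parsing).
Notation vh := 20 (only parsing).
Notation va := 21 (only parsing).
Notation vsl := 22 (only parsing).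
Notation vsr := 23 (only parsing).
Notation vb := 24 (only parsing).
Notation vf := 25 (only parsing).
Notation vx := 26 (only parsing).
Notation vm := 27 (only parsing).
Notation vj := 28 (only parsing).
Notation vd := 29 (only parsing).
Notation vpr := 30 (only parsing).

(* Memory layout: the input; from H on one cell per element, holding the head of
   its list and later its bucket; from N on the list nodes; from D on the trees
   of bucket loads; from P on the moduli; from A on the code. *)
Definition prologue : cmd :=
  (vz ::= get[0] ;; vk ::= get[1] ;; ve ::= get[2] ;; vn ::= $vz * $vk ;;
   vL ::= 1 ;; vt ::= 2 ;;
   While ($vt < $vn + 1) (vt ::= 2 * $vt ;; vL ::= $vL + 1) ;;
   vw ::= $ve * $vL * ($vL + 3) ;;
   vkp ::= 1 ;; While ($vkp < 2 * $vk) (vkp ::= 2 * $vkp) ;;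
   vH ::= 3 + $vz + $vn ;; vN ::= $vH + $vn ;; vD ::= $vN + 2 * $vn ;;
   vP ::= $vD + $vz * (2 * $vkp) ;; vA ::= $vP + $vw)%cmd.

(* Linked lists of the sets containing each element: a node holds the index of
   a set and the address of the next node. *)
Definition build_lists : cmd :=
  (vp ::= 3 + $vz ;; vq ::= $vN ;; vi ::= 0 ;;
   While ($vi < $vz)
    (vc ::= get[3 + $vi] ;;
     While $vc
      (vu ::= get[$vp] ;;
       put[$vq, $vi] ;; put[$vq + 1, get[$vH + $vu]] ;; put[$vH + $vu, $vq] ;;
       vq ::= $vq + 2 ;; vp ::= $vp + 1 ;; vc ::= $vc - 1) ;;
     vi ::= $vi + 1))%cmd.

Definition compare_children : cmd :=
  (va ::= $vh ;; vsl ::= 0 ;; vsr ::= 0 ;;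
   While $va
    (vb ::= $vD + get[$va] * (2 * $vkp) ;;
     vf ::= 2 * $vk - (get[$vb] + 1) ;;
     vb ::= $vb + 2 * $vy ;;
     vsl ::= $vsl + $vf * get[$vb] ;;
     vsr ::= $vsr + $vf * get[$vb + 1] ;;
     va ::= get[$va + 1]) ;;
   vy ::= 2 * $vy + ($vsr < $vsl))%cmd.

Definition descend : cmd :=
  (vy ::= 1 ;; While ($vy < $vkp) compare_children)%cmd.

Definition update_tree : cmd :=
  (vb ::= $vD + get[$va] * (2 * $vkp) ;;
   vf ::= get[$vb + $vy] + 1 ;;
   put[$vb + $vy, get[$vb + $vy] + $vf] ;;
   vx ::= $vy / 2 ;;
   While $vx
    (put[$vb + $vx, get[$vb + $vx] + $vf] ;; vx ::= $vx / 2) ;;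
   put[$vb, get[$vb] + 1])%cmd.

Definition balance : cmd :=
  (vu ::= 0 ;;
   While ($vu < $vn)
    (vh ::= get[$vH + $vu] ;; descend ;; va ::= $vh ;;
     While $va (update_tree ;; va ::= get[$va + 1]) ;;
     put[$vH + $vu, $vy - $vkp] ;; vu ::= $vu + 1))%cmd.

Definition find_moduli : cmd :=
  (vm ::= 2 ;; vj ::= 0 ;;
   While ($vj < $vw)
    (vd ::= 2 ;; vpr ::= 1 ;;
     While (($vd * $vd < $vm + 1) * ($vm < $vn))
      (If ($vm mod $vd) Skip (vpr ::= 0) ;; vd ::= $vd + 1) ;;
     If $vpr (put[$vP + $vj, $vm] ;; vj ::= $vj + 1) Skip ;;
     vm ::= $vm + 1))%cmd.

Definition write_code : cmd :=
  (vx ::= 0 ;;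
   While ($vx < $vn * $vw)
    (put[$vA + $vx, (get[$vH + $vx / $vw] * $vw + $vx mod $vw) * $vm
          + ($vx / $vw) mod get[$vP + $vx mod $vw]] ;;
     vx ::= $vx + 1) ;;
   vell ::= $vkp * $vw * $vm)%cmd.

Definition construction : cmd :=
  (prologue ;; build_lists ;; balance ;; find_moduli ;; write_code)%cmd.

Arguments upd : simpl never.

Lemma upd_eq f a x : upd f a x a = x.
Proof. by rewrite /upd eqxx. Qed.

Lemma upd_ne f a x b : b != a -> upd f a x b = f b.
Proof. by rewrite /upd => /negbTE ->. Qed.

(* The linked list at address [a], with nodes between [lo] and [hi]; the
   address 0 stands for the empty list. *)
Fixpoint chain (m : nat -> nat) (lo hi a : nat) (s : seq nat) : Prop :=
  if s is x :: s' then
    [/\ lo <= a, a.+1 < hi, m a = x & chain m lo hi (m a.+1) s']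
  else a = 0.

Lemma chain_frame m m' lo hi hi' a s :
  (forall x, lo <= x < hi -> m' x = m x) -> hi <= hi' ->
  chain m lo hi a s -> chain m' lo hi' a s.
Proof.
move=> h le; elim: s a => //= x s IH a [h1 h2 h3 /IH h4].
by rewrite !h ?h3; [split=> //; lia | lia | lia].
Qed.

Arguments setv _ _ _ _ /.
Arguments ecost _ /.
Arguments ecode _ /.

Ltac wstep :=
  lazymatch goal with
  | |- wp _ _ (Seq _ _) _ _ _ => apply: wp_seq; wstep
  | |- wp _ _ (Asg _ _) _ _ _ => apply: wp_asg; [by [] | | | | ]; rewrite /=
  | |- wp _ _ (Sto _ _) _ _ _ => apply: wp_sto; rewrite /=
  | _ => idtac
  end.

Ltac regs v :=
  repeat match goal with E : v ?x = _ |- context [v ?x] => rewrite E end.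

Ltac side := try (by repeat (split => //); lia).

Definition env (cst : seq nat) (v : nat -> nat) : Prop :=
  forall x, x < 14 -> v x = nth 0 cst x.

Lemma env_setv cst v x a : 13 < x -> env cst v -> env cst (setv v x a).
Proof. by move=> lx h y ly; rewrite /setv ltn_eqF ?h // (leq_trans ly). Qed.

Ltac envs := repeat (apply: env_setv; [by [] | ]); by [].

(** * Correctness of the phases *)

Section BuildLists.

Variables (W M z k e n L w kp t H N D P A : nat).
Variable l : nat -> seq nat.
Variable m0 : nat -> nat.

Definition off i := \sum_(0 <= i' < i) size (l i').

Hypothesis HE : H = 3 + z + n.
Hypothesis NE : N = H + n.
Hypothesis DE : D = N + 2 * n.
Hypothesis D_M : D <= M.
Hypothesis M_W : M < wsize W.
Hypothesis W_16 : 16 < wsize W.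
Hypothesis l_uniq : forall i, i < z -> uniq (l i).
Hypothesis l_lt : forall i u, i < z -> u \in l i -> u < n.
Hypothesis off_le_n : off z <= n.
Hypothesis m0_size : forall i, i < z -> m0 (3 + i) = size (l i).
Hypothesis m0_elem : forall i j, i < z -> j < size (l i) ->
  m0 (3 + z + off i + j) = nth 0 (l i) j.
Hypothesis m0_0 : forall x, H <= x -> m0 x = 0.

Implicit Types (Q : state -> nat -> Prop).

Let cst := [:: 0; w; A; z; k; e; n; L; t; kp; H; N; D; P].

Lemma offS i : off i.+1 = off i + size (l i).
Proof. by rewrite /off big_nat_recr. Qed.

Lemma off_le i j : i <= j -> off i <= off j.
Proof. by move=> ij; rewrite /off [leqRHS](big_cat_nat (n := i)) //= leq_addr. Qed.

Definition lists_inv q (f : nat -> seq nat) (m : nat -> nat) : Prop :=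
  [/\ forall x, x < H -> m x = m0 x,
      forall x, D <= x -> m x = 0 &
      forall u, u < n -> chain m N (N + 2 * q) (m (H + u)) (f u)].

Lemma lists_push q f m i u : lists_inv q f m -> q < n -> u < n ->
  lists_inv q.+1 (fun u' => if u' == u then i :: f u' else f u')
    (upd (upd (upd m (N + 2 * q) i) (N + 2 * q + 1) (m (H + u))) (H + u) (N + 2 * q)).
Proof.
move=> [h1 h2 h3] qn un; split.
- by move=> x xH; rewrite !upd_ne ?h1 //; lia.
- by move=> x xD; rewrite !upd_ne ?h2 //; lia.
move=> u' un'; case: eqP => [->|/eqP nu].
  rewrite upd_eq /=; split; [lia|lia| |].
    by rewrite 2?upd_ne ?upd_eq //; lia.
  have -> : (N + 2 * q).+1 = N + 2 * q + 1 by lia.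
  rewrite upd_ne; last lia.
  rewrite upd_eq; apply: chain_frame (h3 _ un); last lia.
  by move=> x ?; rewrite !upd_ne //; lia.
rewrite !upd_ne; [|lia..].
apply: chain_frame (h3 _ un'); last lia.
by move=> x ?; rewrite !upd_ne //; lia.
Qed.

Lemma lists_ext q f f' m : (forall u, f u = f' u) -> lists_inv q f m -> lists_inv q f' m.
Proof. by move=> h [h1 h2 h3]; split=> // u un; rewrite -h; apply: h3. Qed.

Definition revadj i u := rev (adj i l u).

Lemma revadjS i u : revadj i.+1 u = if u \in l i then i :: revadj i u else revadj i u.
Proof.
rewrite /revadj /adj /index_iota !subn0 -addn1 iotaD filter_cat rev_cat /=.
by case: ifP.
Qed.

Definition partial_adj i j u :=
  if u \in take j (l i) then i :: revadj i u else revadj i u.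

Lemma partial_adjS i j u : i < z -> j < size (l i) ->
  partial_adj i j.+1 u =
  if u == nth 0 (l i) j then i :: partial_adj i j u else partial_adj i j u.
Proof.
move=> iz jl; rewrite /partial_adj (take_nth 0 jl) mem_rcons inE.
case: eqP => [->|//] /=.
by rewrite in_take_leq ?index_uniq ?l_uniq ?ltnn // ltnW.
Qed.

Lemma build_lists_wp Q v T R :
  env cst v -> 100 * (z + n + 1) + R <= T ->
  (forall v' m' T', env cst v' -> lists_inv n (revadj z) m' -> R <= T' -> Q (v', m') T') ->
  wp W M build_lists (v, m0) T Q.
Proof.
move=> hv hT hQ.
rewrite /build_lists.
have Ez := hv 3 isT; have EN := hv 11 isT; rewrite /= in Ez EN.
wstep; side; wstep; side; wstep; side.
pose Inv (s : state) T' := exists i,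
  [/\ env cst s.1, s.1 16 = i, i <= z, s.1 14 = 3 + z + off i & s.1 15 = N + 2 * off i] /\
  lists_inv (off i) (revadj i) s.2 /\ 60 * ((z - i) + (n - off i)) + 20 + R <= T'.
apply: (wp_while (I := Inv)); last first.
  exists 0; rewrite /= /off big_geq // muln0 !addn0; split; [split=> // | split=> //].
  - envs.
  - by rewrite Ez.
  - split=> // [x xD|u un]; first by apply: m0_0; lia.
    by rewrite /= m0_0; lia.
  - lia.
move=> [v1 m1] T1 [i [[hv1 E16 iz E14 E15] [hl hT1]]] /=; rewrite /= in hv1 E16 E14 E15 hl.
have {}Ez := hv1 3 isT; have EH := hv1 10 isT; rewrite /= in Ez EH.
split; [by side | by side | move=> hc | move=> hc]; last first.
  have ez : i = z by lia.
  apply: hQ => //; last lia.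
  have [h1 h2 h3] := hl; split=> // u un; rewrite -ez.
  apply: chain_frame (h3 u un) => //; rewrite ez; lia.
have {iz} iz : i < z by lia.
have oi := off_le iz; rewrite offS in oi.
have [hlo _ _] := hl.
wstep; side; regs v1; rewrite ?hlo ?m0_size //; try lia.
wstep.
wstep.
pose J (s : state) T' := exists j,
  [/\ env cst s.1, s.1 16 = i, s.1 17 = size (l i) - j, s.1 14 = 3 + z + (off i + j) &
      s.1 15 = N + 2 * (off i + j)] /\
  [/\ j <= size (l i), lists_inv (off i + j) (partial_adj i j) s.2 &
     60 * ((z - i.+1) + (n - (off i + j))) + 40 + R <= T'].
apply: (wp_while (I := J)); last first.
  exists 0; rewrite /= !addn0 subn0; split; split => //; try lia; first envs.
  by apply: lists_ext hl => u; rewrite /partial_adj take0.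
move=> [v2 m2] T2 [j [[hv2 F16 F17 F14 F15] [jl hl2 hT2]]] /=.
rewrite /= in hv2 F16 F17 F14 F15 hl2.
have {}EH := hv2 10 isT; rewrite /= in EH.
split; [by side | by side | move=> hc2 | move=> hc2]; last first.
  have ej : j = size (l i) by lia.
  wstep; side; exists i.+1 => /=; split; [split=> // | split]; try lia.
  - envs.
  - by rewrite F14 ej offS.
  - by rewrite F15 ej offS.
  - rewrite offS -ej; apply: lists_ext hl2 => u.
    by rewrite revadjS /partial_adj ej take_size.
  - rewrite offS; lia.
have {jl} jl : j < size (l i) by lia.
have [hlo2 _ _] := hl2.
have eu : m2 (v2 14) = nth 0 (l i) j by rewrite F14 addnA hlo2 ?m0_elem //; lia.
have un : nth 0 (l i) j < n by apply: l_lt iz _; apply: mem_nth.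
wstep; side; wstep; side; wstep; side; wstep; side; wstep; side; wstep; side; wstep; side.
all: regs v2; try lia.
exists j.+1 => /=; split; [split=> // | split]; try lia.
  envs.
have -> : m2 (3 + z + (off i + j)) = nth 0 (l i) j by rewrite -F14.
rewrite addnS [upd m2 _ _ (H + _)]upd_ne; last lia.
apply: lists_ext (lists_push i hl2 _ un); last lia.
by move=> u; rewrite partial_adjS.
Qed.

End BuildLists.

Section Tree.

Variables (lk : nat).
Let kp := 2 ^ lk.

Definition tree_sum (T : nat -> nat) :=
  forall y, 0 < y < kp -> T y = T (2 * y) + T (2 * y + 1).

Lemma sum_pairs (F : nat -> nat) a b : a <= b ->
  \sum_(a <= y < b) (F (2 * y) + F (2 * y + 1)) = \sum_(2 * a <= y < 2 * b) F y.
Proof.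
move=> /subnKC <-; elim: (b - a) => [|d IH]; first by rewrite addn0 !big_geq.
rewrite addnS big_nat_recr ?leq_addr //= IH mulnS (_ : 2 + 2 * (a + d) = (2 * (a + d)).+2) //.
by rewrite !big_nat_recr ?leq_mul2l ?leq_addr //= ?addn1 ?addnA //; lia.
Qed.

Lemma tree_level T t : tree_sum T -> t <= lk -> T 1 = \sum_(2 ^ t <= y < 2 ^ t.+1) T y.
Proof.
move=> hT; elim: t => [|t IH] lt; first by rewrite expn0 expn1 big_nat1.
rewrite (IH (ltnW lt)) [in RHS]expnS [2 ^ t.+2]expnS -sum_pairs; last first.
  by rewrite leq_exp2l.
rewrite big_nat [RHS]big_nat; apply: eq_bigr => y /andP[y1 y2].
apply: hT; rewrite (leq_trans _ y1) ?expn_gt0 // (leq_trans y2) //.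
by rewrite leq_exp2l.
Qed.

Lemma tree_leaves T : tree_sum T -> T 1 = \sum_(0 <= b < kp) T (kp + b).
Proof.
move=> hT; rewrite (tree_level hT (leqnn lk)) -{1}[2 ^ lk]add0n big_addn.
rewrite (_ : 2 ^ lk.+1 - 2 ^ lk = kp); last by rewrite /kp expnS; lia.
by apply: eq_bigr => b _; rewrite addnC.
Qed.

Lemma tree_le T y : tree_sum T -> 0 < y < 2 * kp -> T y <= T 1.
Proof.
move=> hT; have [N] := ubnP y; elim: N y => // N IH y leN /andP[y0 yk].
case: (ltnP 1 y) => [y1|]; last by move=> ?; rewrite (_ : y = 1) //; lia.
apply: leq_trans (IH y./2 _ _); [|lia|lia].
rewrite (hT y./2); last lia.
by rewrite -{1}(odd_double_half y) -mul2n; case: (odd y); rewrite ?add1n ?add0n ?addn1; lia.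
Qed.

End Tree.

Section BalanceCorrect.

Variables (W M z k e n L w lk kp t H N D P A : nat).
Variable l : nat -> seq nat.

Definition cell (m : nat -> nat) i x := m (D + i * (2 * kp) + x).

(* The array of a set [i] holds at 0 the number of its elements that have been
   placed, and from 1 on a binary tree of sums whose leaves are the numbers
   2 ^ load - 1; thus a zero memory is already initialized. *)
Definition represents g u i (C : nat -> nat) :=
  [/\ C 0 = seen l i u, tree_sum lk C &
      forall b, b < kp -> (C (kp + b)).+1 = 2 ^ load l g i u b].

Hypothesis z0 : 0 < z.
Hypothesis k0 : 0 < k.
Hypothesis kpE : kp = 2 ^ lk.
Hypothesis kp_ge : 2 * k <= kp.
Hypothesis NE : N = H + n.
Hypothesis ND : N <= D.
Hypothesis N0 : 0 < N.
Hypothesis PE : P = D + z * (2 * kp).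
Hypothesis P_M : P <= M.
Hypothesis M_W : M < wsize W.
Hypothesis W_16 : 16 < wsize W.
Hypothesis W_pot : 2 * (z * (2 * k * kp)) + 2 < wsize W.
Hypothesis l_uniq : forall i, i < z -> uniq (l i).
Hypothesis l_size : forall i, i < z -> size (l i) <= k.

Implicit Types (Q : state -> nat -> Prop).

Let cst := [:: 0; w; A; z; k; e; n; L; t; kp; H; N; D; P].

Lemma kp_gt0 : 0 < kp. Proof. by rewrite kpE expn_gt0. Qed.

Lemma cell_lt i x : i < z -> x < 2 * kp -> D + i * (2 * kp) + x < P.
Proof.
move=> iz xk; rewrite PE -addnA ltn_add2l.
apply: leq_trans (_ : i.+1 * (2 * kp) <= _); first by rewrite mulSn; lia.
by rewrite leq_mul2r iz orbT.
Qed.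

Lemma kp_le i : i < z -> 2 * kp <= P.
Proof. by move=> iz; rewrite PE; apply: leq_trans (leq_addl _ _); rewrite leq_pmull //; lia. Qed.

Lemma kp2_P : 2 * kp <= P.
Proof. exact: kp_le z0. Qed.

Lemma chain_lt_M m a s : chain m N D a s -> a < M.
Proof. by case: s => /= [->|x s []]; [lia | move=> *; lia]. Qed.

Lemma represents_root g u i C : represents g u i C -> C 1 + kp = mass kp l g i u.
Proof.
move=> [_ hT hl]; rewrite (tree_leaves hT) -kpE.
rewrite -[X in _ + X](_ : \sum_(0 <= b < kp) 1 = kp); last first.
  by rewrite sum_nat_const_nat subn0 muln1.
rewrite -big_split /= /mass big_nat [RHS]big_nat.
by apply: eq_bigr => b /andP[_ bk]; rewrite -hl // addn1.
Qed.

Lemma represents_ext g g' u i C C' : (forall v, v < u -> g v = g' v) ->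
  (forall x, x < 2 * kp -> C x = C' x) -> represents g u i C -> represents g' u i C'.
Proof.
move=> hg hC [h1 h2 h3]; have := kp_gt0 => kpp; split.
- by rewrite -hC //; lia.
- move=> y yk; rewrite -(hC y) -1?(hC (2 * y)) -1?(hC (2 * y + 1)); [exact: h2|lia..].
- by move=> b bk; rewrite -hC ?h3 //; [rewrite (load_ext _ _ _ hg) | lia].
Qed.

Lemma represents_skip g u i C : i < z -> u \notin l i ->
  represents g u i C -> represents g u.+1 i C.
Proof.
move=> iz ul [h1 h2 h3]; split=> //.
  by rewrite (seen_step (z := z)) // (negbTE ul) addn0.
by move=> b bk; rewrite h3 // (load_step (z := z)) // (negbTE ul) andbF addn0.
Qed.

Definition weighted (s : seq nat) (m : nat -> nat) x :=
  \sum_(i <- s) (2 * k - (cell m i 0 + 1)) * cell m i x.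

Lemma weighted_nil m x : weighted [::] m x = 0.
Proof. by rewrite /weighted big_nil. Qed.

Lemma weighted_cons i s m x : weighted (i :: s) m x =
  (2 * k - (cell m i 0 + 1)) * cell m i x + weighted s m x.
Proof. by rewrite /weighted big_cons. Qed.

Lemma compare_children_wp Q v m T R s y :
  env cst v -> v 19 = y -> 0 < y < kp -> chain m N D (v 20) s ->
  (forall i, i \in s -> i < z /\ cell m i 0 < k) ->
  weighted s m (2 * y) < wsize W -> weighted s m (2 * y + 1) < wsize W ->
  40 + 80 * size s + R <= T ->
  (forall v' T', env cst v' -> v' 18 = v 18 -> v' 20 = v 20 ->
     v' 19 = 2 * y + (weighted s m (2 * y + 1) < weighted s m (2 * y)) ->
     R <= T' -> Q (v', m) T') ->
  wp W M compare_children (v, m) T Q.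
Proof.
move=> hv Ey yk hch hs hwl hwr hT hQ; rewrite /compare_children.
have := kp_gt0 => kpp.
have Hh := chain_lt_M hch; wstep; side.
wstep; side; wstep; side.
pose Inv (st : state) T' := exists s2,
  [/\ env cst st.1, st.1 18 = v 18, st.1 20 = v 20, st.1 19 = y & st.2 = m] /\
  [/\ chain m N D (st.1 21) s2, {subset s2 <= s},
      st.1 22 + weighted s2 m (2 * y) = weighted s m (2 * y),
      st.1 23 + weighted s2 m (2 * y + 1) = weighted s m (2 * y + 1) &
      20 + 80 * size s2 + R <= T'].
apply: wp_seq; apply: (wp_while (I := Inv)); last first.
  by exists s; split; split=> //=; [envs | lia].
move=> [v1 m1] T1 [s2 [[hv1 E18 E20 E19 /= em] [hc1 ss El Er hT1]]]; subst m1.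
rewrite /= in hv1 E18 E20 E19 hc1 El Er.
have Ek := hv1 4 isT; have Ekp := hv1 9 isT; have ED := hv1 12 isT.
rewrite /= in Ek Ekp ED.
split; [by side | by side | move=> hc | move=> hc].
  case: s2 hc1 ss El Er hT1 => [|i s2] /= hc1 ss El Er hT1; first by [].
  have [a1 a2 Ea hc2] := hc1.
  have [iz ik] := hs i (ss _ (mem_head _ _)).
  have kP := kp_le iz.
  have c2 := cell_lt (x := 2 * y + 1) iz.
  have c0 := cell_lt (x := 0) iz.
  rewrite !weighted_cons in El Er.
  have e0 : m (D + i * (2 * kp)) = cell m i 0 by rewrite /cell addn0.
  have e1 : m (D + i * (2 * kp) + 2 * y) = cell m i (2 * y) by [].
  have e2 : m (D + i * (2 * kp) + 2 * y + 1) = cell m i (2 * y + 1) by rewrite /cell addnA.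
  rewrite /= in c0 c2; have {}c0 := c0 ltac:(lia); have {}c2 := c2 ltac:(lia).
  have [fv Ef] : exists fv, fv = 2 * k - (cell m i 0 + 1) by eexists.
  rewrite -Ef in El Er.
  have Ea' : m (v1 21 + 1) = m (v1 21).+1 by rewrite addn1.
  wstep; regs v1; regs m; try lia; first by repeat split; lia.
  wstep; regs v1; regs m; rewrite -?Ef; try lia; first by repeat split; lia.
  wstep; regs v1; regs m; rewrite -?Ef; try lia; first by repeat split; lia.
  wstep; regs v1; regs m; rewrite -?Ef; try lia; first by repeat split; lia.
  wstep; regs v1; regs m; rewrite -?Ef; try lia; first by repeat split; lia.
  have Nx := chain_lt_M hc2.
  wstep; regs v1; regs m; rewrite -?Ef; try lia.
    by repeat split; lia.
  exists s2; split; split=> //=; try lia; first envs.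
  by move=> x xs; apply: ss; rewrite inE xs orbT.
case: s2 hc1 ss El Er hT1 => [|i s2] /= hc1 ss El Er hT1; last first.
  by have [] := hc1; lia.
rewrite !weighted_nil !addn0 in El Er.
have c0 : 2 * kp <= M by apply: leq_trans P_M; exact: kp2_P.
wstep; regs v1; rewrite ?El ?Er; try lia; first by repeat split; lia.
by apply: hQ => //=; [envs | lia].
Qed.

Lemma weighted_tree s m y : (forall i, i \in s -> tree_sum lk (cell m i)) -> 0 < y < kp ->
  weighted s m y = weighted s m (2 * y) + weighted s m (2 * y + 1).
Proof.
move=> hs yk; rewrite /weighted -big_split /= big_seq [RHS]big_seq.
by apply: eq_bigr => i /hs ht; rewrite (ht y) -?kpE // mulnDr.
Qed.

Lemma descend_wp Q v m T R s :
  env cst v -> chain m N D (v 20) s ->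
  (forall i, i \in s -> [/\ i < z, cell m i 0 < k & tree_sum lk (cell m i)]) ->
  weighted s m 1 < wsize W ->
  20 + (lk + 1) * (50 + 80 * size s) + R <= T ->
  (forall v' T' y, env cst v' -> v' 18 = v 18 -> v' 20 = v 20 -> v' 19 = y ->
     kp <= y < 2 * kp -> kp * weighted s m y <= weighted s m 1 ->
     R <= T' -> Q (v', m) T') ->
  wp W M descend (v, m) T Q.
Proof.
move=> hv hch hs hw hT hQ; rewrite /descend; have kpp := kp_gt0.
wstep; [lia|lia|lia|].
pose Inv (st : state) T' := exists d y,
  [/\ env cst st.1, st.1 18 = v 18, st.1 20 = v 20, st.1 19 = y & st.2 = m] /\
  [/\ d <= lk, 2 ^ d <= y < 2 ^ d.+1, 2 ^ d * weighted s m y <= weighted s m 1 &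
      10 + (lk - d + 1) * (50 + 80 * size s) + R <= T'].
apply: (wp_while (I := Inv)); last first.
  exists 0, 1; split; split=> //=; first envs; first by rewrite mul1n.
  by rewrite subn0; lia.
move=> [v1 m1] T1 [d [y [[hv1 E18 E20 E19 /= em] [dl yd wd hT1]]]]; subst m1.
rewrite /= in hv1 E18 E20 E19.
have Ekp := hv1 9 isT; rewrite /= in Ekp.
have fuel : 50 + 80 * size s <= (lk - d + 1) * (50 + 80 * size s) by rewrite leq_pmull //; lia.
split; [by side | rewrite /=; lia | move=> hc | move=> hc]; rewrite /= in hc.
  have yk : y < kp by lia.
  have d0 : 0 < 2 ^ d by rewrite expn_gt0.
  have dlk : d < lk.
    rewrite ltnNge; apply/negP => le; have e1 : d = lk by lia.
    by move: yd; rewrite e1 -kpE; lia.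
  have wt : weighted s m y = weighted s m (2 * y) + weighted s m (2 * y + 1).
    apply: weighted_tree => [i /hs[] //|]; by lia.
  have wy : weighted s m y <= weighted s m 1.
    by apply: leq_trans wd; rewrite leq_pmull.
  apply: (compare_children_wp (R := 10 + (lk - d.+1 + 1) * (50 + 80 * size s) + R) hv1 E19).
  - by lia.
  - by rewrite E20; exact: hch.
  - by move=> i /hs[].
  - by lia.
  - by lia.
  - by rewrite (_ : lk - d + 1 = (lk - d.+1 + 1).+1) in hT1; [rewrite mulSn in hT1; rewrite /=; lia | lia].
  move=> v' T' hv' F18 F20 F19 hT'.
  exists d.+1, (2 * y + (weighted s m (2 * y + 1) < weighted s m (2 * y))).
  split; split=> //=; rewrite ?F18 ?F20 //.
  - move: yd; rewrite !expnS; move: (weighted _ _ _ < _) => b; case: b; lia.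
  - apply: leq_trans wd; rewrite expnS (mulnC 2) -mulnA leq_mul2l; apply/orP; right.
    case: ltnP => lt; rewrite /= ?addn0 wt; lia.
have yk : kp <= y by lia.
have ed : d = lk.
  apply/eqP; rewrite eqn_leq dl leqNgt; apply/negP => lt.
  have : 2 ^ d.+1 <= kp by rewrite kpE leq_exp2l.
  lia.
apply: (hQ v1 _ y) => //; last lia.
- by move: yd; rewrite ed expnS -kpE.
- by move: wd; rewrite ed -kpE.
Qed.

Lemma update_tree_wp Q v m T R i y :
  env cst v -> v 21 < M -> m (v 21) = i -> i < z -> v 19 = y -> kp <= y < 2 * kp ->
  tree_sum lk (cell m i) -> cell m i 0 < k -> cell m i 1 + cell m i y + 1 < wsize W ->
  80 + 40 * lk + R <= T ->
  (forall v' m' T', env cst v' -> v' 18 = v 18 -> v' 19 = v 19 -> v' 20 = v 20 ->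
     v' 21 = v 21 ->
     (forall q, ~~ (D + i * (2 * kp) <= q < D + i * (2 * kp) + 2 * kp) -> m' q = m q) ->
     cell m' i 0 = cell m i 0 + 1 -> tree_sum lk (cell m' i) ->
     (forall b, b < kp -> cell m' i (kp + b) =
        cell m i (kp + b) + (if kp + b == y then cell m i y + 1 else 0)) ->
     R <= T' -> Q (v', m') T') ->
  wp W M update_tree (v, m) T Q.
Proof.
move=> hv aM ma iz Ey yk ht c0 cb hT hQ; rewrite /update_tree.
have kpp := kp_gt0; have cl x := @cell_lt i x iz; have kP := kp2_P.
have hle x : 0 < x < 2 * kp -> cell m i x <= cell m i 1.
  by move=> hx; apply: tree_le ht _; rewrite -kpE.
have [B EB] : exists B, B = D + i * (2 * kp) by eexists.
rewrite /cell -!EB in ht c0 cb hQ cl hle.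
have {}cl x : x < 2 * kp -> B + x < P by move/cl; rewrite EB.
have BP := cl (2 * kp).-1 ltac:(lia).
have Ekp := hv 9 isT; have ED := hv 12 isT; rewrite /= in Ekp ED.
have [f Ef] : exists f, f = m (B + y) + 1 by eexists.
have by1 := cl y ltac:(lia).
have hy := hle y ltac:(lia).
rewrite addn0 in c0 hQ.
do 4 (wstep; regs v; regs m; rewrite -?EB -?Ef; try lia; first by repeat split; lia).
pose m2 := upd m (B + y) (m (B + y) + f).
pose Inv (st : state) T' := exists d x,
  [/\ env cst st.1, st.1 18 = v 18, st.1 19 = v 19, st.1 20 = v 20 & st.1 21 = v 21] /\
  [/\ st.1 26 = x, st.1 24 = B, st.1 25 = f, x < 2 ^ d & d <= lk] /\
  [/\ 20 + 30 * d + R <= T', forall q, ~~ (B < q < B + kp) -> st.2 q = m2 q,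
      forall y', 0 < y' < kp -> st.2 (B + y') + (if y' == x then f else 0) =
         st.2 (B + 2 * y') + st.2 (B + (2 * y' + 1)) &
      forall y', 0 < y' <= x -> st.2 (B + y') = m (B + y')].
apply: wp_seq; apply: (wp_while (I := Inv)); last first.
  exists lk, (y %/ 2); split; split=> //=; try lia.
  - envs.
  - by split=> //; rewrite -kpE; lia.
  - split=> //=; first lia.
    move=> y' yk'; rewrite /m2 upd_ne; last lia.
    rewrite ht; last by rewrite -kpE.
    rewrite /upd; case: (y' =P y %/ 2) => e1.
      have [->|e2] : y = 2 * y' \/ y = 2 * y' + 1 by lia.
        by rewrite eqxx; case: eqP; lia.
      by rewrite e2 eqxx; case: eqP; lia.
    by do 2 (case: eqP; [lia|]); lia.
  - move=> y' yk'; rewrite /m2 upd_ne //; lia.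
move=> [v1 m1] T1 [d [x [[hv1 E18 E19 E20 E21] [[E26 E24 E25 xd dl] [hT1 h1 h2 h3]]]]].
rewrite /= in hv1 E18 E19 E20 E21 E26 E24 E25 h1 h2 h3.
split; [by side | rewrite /=; lia | move=> hc | move=> hc]; rewrite /= in hc.
  case: d xd dl hT1 => [|d] xd dl hT1; first by rewrite expn0 in xd; lia.
  have xk : x < kp by rewrite kpE (leq_trans xd) // leq_exp2l.
  have bx := cl x ltac:(lia); have hx := hle x ltac:(lia); have h3x := h3 x ltac:(lia).
  do 2 (wstep; regs v1; try lia; first by repeat split; lia).
  exists d, (x %/ 2); split; split=> //=; try lia; first envs.
    by rewrite expnS in xd; split=> //; lia.
  split=> //; first lia.
  - by move=> q hq; rewrite upd_ne ?h1 //; lia.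
  - move=> y' yk'; have := h2 y' yk'.
    rewrite /upd; case: (y' =P x %/ 2) => e1.
      rewrite (_ : (B + y' == B + x) = false); last lia.
      rewrite (_ : (y' == x) = false); last lia.
      have [->|e2] : x = 2 * y' \/ x = 2 * y' + 1 by lia.
        by rewrite eqxx; case: eqP; lia.
      by rewrite e2 eqxx; case: eqP; lia.
    rewrite (_ : (B + 2 * y' == B + x) = false); last lia.
    rewrite (_ : (B + (2 * y' + 1) == B + x) = false); last lia.
    by rewrite eqn_add2l; case: (y' =P x) => [->|]; lia.
  - by move=> y' hy'; rewrite upd_ne ?h3 //; lia.
have x0 : x = 0 by lia.
have eB : m1 B = m B by rewrite h1 ?/m2 ?upd_ne //; lia.
wstep; regs v1; rewrite ?eB; try lia; first by repeat split; lia.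
  by repeat split; lia.
apply: hQ => //=; try lia.
- by move=> q hq; rewrite upd_ne ?h1 ?/m2 ?upd_ne //; lia.
- by rewrite upd_eq.
- move=> y'; rewrite -kpE => yk'; rewrite !upd_ne; [|lia..].
  by have := h2 y' yk'; rewrite x0; case: eqP; lia.
- move=> b bk; rewrite upd_ne; last lia.
  rewrite h1 /m2; last lia.
  case: eqP => [e1|ne]; last by rewrite upd_ne ?addn0 //; lia.
  by rewrite e1 upd_eq Ef.
Qed.

Lemma cell_disjoint i j x : i != j -> x < 2 * kp ->
  ~~ (D + i * (2 * kp) <= D + j * (2 * kp) + x < D + i * (2 * kp) + 2 * kp).
Proof.
move=> ij xk; have [lt|lt|/eqP] := ltngtP i j; last by rewrite (negbTE ij).
  have : i.+1 * (2 * kp) <= j * (2 * kp) by rewrite leq_mul2r lt orbT.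
  by rewrite mulSn; lia.
have : j.+1 * (2 * kp) <= i * (2 * kp) by rewrite leq_mul2r lt orbT.
by rewrite mulSn; lia.
Qed.

Lemma represents_update g u i C C' y : i < z -> u \in l i -> g u = y - kp -> kp <= y ->
  represents g u i C -> C' 0 = C 0 + 1 -> tree_sum lk C' ->
  (forall b, b < kp -> C' (kp + b) = C (kp + b) + (if kp + b == y then C y + 1 else 0)) ->
  represents g u.+1 i C'.
Proof.
move=> iz ui gu ky [h1 h2 h3] e0 ht hl; split=> //.
  by rewrite e0 h1 (seen_step (z := z)) // ui.
move=> b bk; rewrite hl // (load_step (z := z)) // ui andbT gu.
case: eqP => e1.
  rewrite (_ : (y - kp == b) = true) /=; last lia.
  by rewrite [load _ _ _ _ _ + 1]addn1 expnS -h3 // e1; lia.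
by rewrite (_ : (y - kp == b) = false) ?addn0 ?h3 //; lia.
Qed.

Definition balanced u g m :=
  [/\ forall v, v < u -> m (H + v) = g v /\ g v < kp,
      forall v, u <= v < n -> chain m N D (m (H + v)) (revadj l z v),
      forall i, i < z -> represents g u i (cell m i) &
      pot z k kp l g u <= z * (2 * k * kp)].

Lemma mem_revadj u i : (i \in revadj l z u) = (i < z) && (u \in l i).
Proof. by rewrite mem_rev mem_adj. Qed.

Lemma weighted_root g u m : balanced u g m ->
  weighted (revadj l z u) m 1 + kp * \sum_(i <- adj z l u) (2 * k - (seen l i u).+1) =
  \sum_(i <- adj z l u) (2 * k - (seen l i u).+1) * mass kp l g i u.
Proof.
move=> [_ _ hr _]; rewrite /weighted /revadj (perm_big _ (permEl (perm_rev _))) /=.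
rewrite big_distrr -big_split /= big_seq [RHS]big_seq; apply: eq_bigr => i.
rewrite mem_adj => /andP[iz _]; have hi := hr i iz.
by rewrite -(represents_root hi); case: hi => -> _ _; rewrite addn1 mulnDr [kp * _]mulnC.
Qed.

Lemma weighted_leaf g u m b : balanced u g m -> b < kp ->
  weighted (revadj l z u) m (kp + b) + \sum_(i <- adj z l u) (2 * k - (seen l i u).+1) =
  \sum_(i <- adj z l u) (2 * k - (seen l i u).+1) * 2 ^ load l g i u b.
Proof.
move=> [_ _ hr _] bk; rewrite /weighted /revadj (perm_big _ (permEl (perm_rev _))) /=.
rewrite -big_split /= big_seq [RHS]big_seq; apply: eq_bigr => i.
rewrite mem_adj => /andP[iz _]; have [-> _ hl] := hr i iz.
by rewrite -hl // addn1 mulnS addnC.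
Qed.

Lemma weighted_root_pot g u m : balanced u g m ->
  weighted (revadj l z u) m 1 <= z * (2 * k * kp).
Proof.
move=> hb; have [_ _ _ hp] := hb; apply: leq_trans hp.
apply: leq_trans (sum_adj_pot z k kp l g u).
apply: leq_trans (leq_addr (kp * \sum_(i <- adj z l u) (2 * k - (seen l i u).+1)) _) _.
rewrite (weighted_root hb); apply: leq_sum => i _; rewrite leq_mul2r; apply/orP; right; lia.
Qed.

Lemma pot_place g u m b : balanced u g m -> b < kp ->
  kp * weighted (revadj l z u) m (kp + b) <= weighted (revadj l z u) m 1 ->
  pot z k kp l (fun v => if v == u then b else g v) u.+1 <= z * (2 * k * kp).
Proof.
move=> hb bk hw; set g' := fun v => _; have [_ _ _ hp] := hb; apply: leq_trans hp.
have hg v : v < u -> g v = g' v by move=> vu; rewrite /g' ltn_eqF.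
rewrite (pot_ext z k kp l hg).
have gu : g' u = b by rewrite /g' eqxx.
apply: pot_step => //; rewrite ?gu ?kp_gt0 //.
under eq_bigr => i _ do rewrite -(load_ext l i b hg).
under [leqRHS]eq_bigr => i _ do rewrite -(mass_ext kp l i hg).
rewrite -(weighted_root hb) -(weighted_leaf hb bk) mulnDr leq_add2r.
exact: hw.
Qed.

Lemma balance_wp Q v m T R g0 :
  env cst v -> balanced 0 g0 m ->
  50 + 300 * ((lk + 1) * \sum_(0 <= u < n) (1 + size (adj z l u))) + R <= T ->
  (forall v' m' T' g, env cst v' -> balanced n g m' -> R <= T' -> Q (v', m') T') ->
  wp W M balance (v, m) T Q.
Proof.
move=> hv hb hT hQ; rewrite /balance; have kpp := kp_gt0.
wstep; [lia|lia|lia|].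
pose rest u := \sum_(u <= x < n) (1 + size (adj z l x)).
pose Inv (st : state) T' := exists u g,
  [/\ env cst st.1, st.1 18 = u, u <= n, balanced u g st.2 &
      20 + 300 * ((lk + 1) * rest u) + R <= T'].
apply: (wp_while (I := Inv)); last first.
  by exists 0, g0; split=> //=; [envs | rewrite /rest; lia].
move=> [v1 m1] T1 [u [g [hv1 E18 un hb1 hT1]]].
rewrite /= in hv1 E18 hb1.
have En := hv1 6 isT; have EH := hv1 10 isT; rewrite /= in En EH.
split; [rewrite /=; side | rewrite /=; lia | move=> hc | move=> hc]; rewrite /= in hc; last first.
  have eu : u = n by lia.
  by apply: (hQ v1 m1 _ g) => //; [rewrite -eu | rewrite /=; lia].
have {un} un : u < n by lia.
have er : rest u = 1 + size (adj z l u) + rest u.+1 by rewrite /rest big_ltn.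
pose s := revadj l z u.
have ss : size s = size (adj z l u) by rewrite size_rev.
rewrite er -ss in hT1.
have [hh hch hrep hpot] := hb1.
have hchu : chain m1 N D (m1 (H + u)) s by apply: hch; rewrite leqnn.
have hN := chain_lt_M hchu; have kP := kp2_P.
wstep; regs v1; try lia; first by repeat split; lia.
pose R2 := 50 + (140 * (lk + 1)) * size s + 300 * ((lk + 1) * rest u.+1) + R.
apply: wp_seq; apply: (descend_wp (R := R2) (s := s)).
- envs.
- by [].
- move=> i; rewrite mem_revadj => /andP[iz ui]; have [-> ? _] := hrep i iz.
  by split=> //; apply: (seen_lt (z := z)).
- have := weighted_root_pot hb1; rewrite -/s; lia.
- rewrite /R2 /=; lia.
move=> v2 T2 y hv2 /= F18 F20 F19 yk hy hT2.
pose b := y - kp; have bk : b < kp by rewrite /b; lia.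
have yb : y = kp + b by rewrite /b; lia.
pose g' v := if v == u then b else g v.
have hg x : x < u -> g x = g' x by move=> xu; rewrite /g' ltn_eqF.
have hchk : v2 20 < M by rewrite F20.
wstep; side.
pose J (st : state) T' := exists s2,
  [/\ env cst st.1, st.1 18 = u, st.1 19 = y & chain st.2 N D (st.1 21) s2] /\
  [/\ uniq s2, {subset s2 <= s},
      forall i, i < z -> represents g' (if i \in s2 then u else u.+1) i (cell st.2 i),
      forall q, q < D -> st.2 q = m1 q &
      40 + (140 * (lk + 1)) * size s2 + 300 * ((lk + 1) * rest u.+1) + R <= T'].
apply: wp_seq; apply: (wp_while (I := J)); last first.
  exists s; split; split=> //=.
  - envs.
  - by rewrite F18.
  - by rewrite F20.
  - by rewrite rev_uniq adj_uniq.
  - move=> i iz; rewrite mem_revadj iz /=; case: ifP => ui.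
      by apply: represents_ext (hrep i iz).
    by apply: represents_skip; rewrite ?ui //; apply: represents_ext (hrep i iz).
  - rewrite /R2 in hT2; lia.
move=> [v3 m3] T3 [s2 [[hv3 G18 G19 hc3] [us2 sub2 hr3 hf3 hT3]]].
rewrite /= in hv3 G18 G19 hc3 hr3 hf3.
have {}En := hv3 6 isT; have {}EH := hv3 10 isT; have Ekp := hv3 9 isT; rewrite /= in En EH Ekp.
split; [by rewrite /=; side | rewrite /=; lia | move=> hc4 | move=> hc4]; rewrite /= in hc4; last first.
  case: s2 hc3 us2 sub2 hr3 hT3 => [|i s2] hc3 us2 sub2 hr3 hT3; last first.
    by case: hc3; lia.
  wstep; regs v3; try lia; first by repeat split; lia.
    by repeat split; lia.
  wstep; regs v3; try lia; first by repeat split; lia.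
  exists u.+1, g'; split=> //=; [envs | lia | | lia]; split.
  - move=> x xu; case: (x =P u) => [->|nx]; first by rewrite upd_eq /g' eqxx.
    have xu' : x < u by lia.
    rewrite upd_ne; last lia.
    by rewrite hf3 -?hg; [exact: hh | | lia].
  - move=> x hx; rewrite upd_ne; last lia.
    rewrite hf3; last lia.
    apply: chain_frame (leqnn _) (hch x _); last lia.
    by move=> q hq; rewrite upd_ne ?hf3 //; lia.
  - move=> i iz; apply: represents_ext (hr3 i iz) => // x xk.
    by rewrite /cell upd_ne //; lia.
  - by apply: (pot_place hb1 bk); rewrite -yb.
case: s2 hc3 us2 sub2 hr3 hT3 => [|i s2] //= [a1 a2 Ea hc3] /andP[is2 us2] sub2 hr3 hT3.
have : i \in s by apply: sub2; rewrite inE eqxx.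
rewrite mem_revadj => /andP[iz ui].
have hri : represents g' u i (cell m3 i) by have := hr3 i iz; rewrite inE eqxx.
have cb x : 0 < x < 2 * kp -> cell m3 i x <= z * (2 * k * kp).
  move=> hx; have [_ ht _] := hri; apply: leq_trans (tree_le ht _) _; first by rewrite -kpE.
  apply: leq_trans (leq_addr kp _) _; rewrite (represents_root hri) -(mass_ext _ _ _ hg).
  apply: leq_trans hpot; apply: leq_trans (mass_pot k kp l g u iz).
  by rewrite leq_pmull //; have := seen_le l_size u iz; lia.
have [c0 ht hl] := hri.
have cb1 := cb 1 ltac:(lia); have cby := cb y ltac:(lia).
have sk : seen l i u < k by apply: (seen_lt (z := z)).
have Nx := chain_lt_M hc3.
apply: wp_seq; apply: (update_tree_wp (R := 60 + (140 * (lk + 1)) * size s2 + 300 * ((lk + 1) * rest u.+1) + R)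
  hv3 _ Ea iz G19 yk ht); [lia|lia|lia|lia|].
move=> v4 m4 T4 hv4 H18 H19 H20 H21 hfr hz ht4 hl4 hT4.
have Em q : q < D -> m4 q = m3 q by move=> qD; apply: hfr; lia.
have Ea' : m4 (v4 21 + 1) = m3 (v3 21).+1 by rewrite addn1 H21 Em //; lia.
wstep; rewrite ?Ea'; try lia; first by repeat split; lia.
exists s2; split; split=> //=.
- envs.
- by rewrite H18.
- by rewrite H19.
- by apply: chain_frame (leqnn _) hc3 => q hq; apply: Em; lia.
- by move=> x xs; apply: sub2; rewrite inE xs orbT.
- move=> j jz; have := hr3 j jz; rewrite inE; case: (j =P i) => [->|/eqP ji] /=.
    rewrite (negbTE is2) => _.
    by apply: (represents_update iz ui _ _ hri hz ht4 hl4); [rewrite /g' eqxx | lia].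
  apply: represents_ext => // x xk; rewrite /cell hfr //.
  by apply: cell_disjoint; rewrite // eq_sym.
- by move=> q qD; rewrite Em // hf3.
- lia.
Qed.

End BalanceCorrect.

Definition no_divisor x d := all (fun c => ~~ (c %| x)) (index_iota 2 d).

Lemma no_divisorS x d : 2 <= d -> no_divisor x d.+1 = no_divisor x d && ~~ (d %| x).
Proof.
move=> d2; rewrite /no_divisor /index_iota subSn // -[(d - 2).+1]addn1 iotaD subnKC // all_cat /=.
by rewrite andbT.
Qed.

Lemma no_divisor_good n x d : 2 <= x -> 2 <= d ->
  d = 2 \/ x < n /\ (d - 1) * (d - 1) <= x -> n <= x \/ x < d * d ->
  no_divisor x d = good_modulus n x.
Proof.
move=> x2 d2 hd hx; rewrite /good_modulus; case: leqP => [nx|xn] /=.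
  by case: hd => [->|[]]; rewrite // leqNgt ?ltnNge ?nx //; lia.
have {hx} xd : x < d * d by case: hx => //; lia.
apply/allP/idP => [h|px c].
  apply: contraLR isT => /(contra (ltn_pdiv2_prime (ltnW x2))).
  rewrite -leqNgt => le; have pd : pdiv x < d.
    rewrite ltnNge; apply/negP => dp; suff : d * d <= x by lia.
    by apply: leq_trans le; rewrite -mulnn leq_mul.
  by have := h (pdiv x); rewrite mem_index_iota pdiv_dvd prime_gt1 ?pdiv_prime // => /(_ pd).
rewrite mem_index_iota => /andP[c2 cd]; apply/negP => /(primeP px).2.
case/orP => /eqP ec; first lia.
by move: hd => [|[_]]; nia.
Qed.

Section FindModuli.

Variables (W M z k e n L w kp t H N D P A Y0 r : nat).

Hypothesis w0 : 0 < w.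
Hypothesis w_count : w <= count (good_modulus n) (index_iota 2 Y0.+1).
Hypothesis r_sqrt : n <= r * r.
Hypothesis P_M : P + w <= M.
Hypothesis M_W : M < wsize W.
Hypothesis W_16 : 16 < wsize W.
Hypothesis W_Y0 : (Y0 + 2) * (Y0 + 2) < wsize W.
Hypothesis n_M : n <= M.

Implicit Types (Q : state -> nat -> Prop).

Let cst := [:: 0; w; A; z; k; e; n; L; t; kp; H; N; D; P].

Lemma find_moduli_wp Q v m T R :
  env cst v -> 60 + (100 + 50 * r) * Y0 + R <= T ->
  (forall v' m' T' Y, env cst v' -> v' 27 = Y -> 2 <= Y <= Y0.+1 ->
     (forall q, q < P -> m' q = m q) ->
     mkseq (fun q => m' (P + q)) w = [seq p <- index_iota 2 Y | good_modulus n p] ->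
     R <= T' -> Q (v', m') T') ->
  wp W M find_moduli (v, m) T Q.
Proof.
move=> hv hT hQ; rewrite /find_moduli.
have Y0_1 : 0 < Y0 by move: w_count; case: (Y0) => //=; lia.
do 2 (wstep; side).
pose Inv (st : state) T' := exists x j,
  [/\ env cst st.1, st.1 27 = x, st.1 28 = j & 40 + (100 + 50 * r) * (Y0.+1 - x) + R <= T'] /\
  [/\ 2 <= x, x <= Y0.+1, j <= w,
      forall q, q < P -> st.2 q = m q &
      mkseq (fun q => st.2 (P + q)) j = [seq p <- index_iota 2 x | good_modulus n p]].
apply: (wp_while (I := Inv)); last first.
  by exists 2, 0; split; split=> //=; try lia; envs.
move=> [v1 m1] T1 [x [j [[hv1 E27 E28 hT1] [x2 xY jw hf hps]]]].
rewrite /= in hv1 E27 E28 hf hps.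
have Ew := hv1 1 isT; have En := hv1 6 isT; have EP := hv1 13 isT; rewrite /= in Ew En EP.
split; [by rewrite /=; side | rewrite /=; lia | move=> hc | move=> hc]; rewrite /= in hc; last first.
  have ej : j = w by lia.
  by apply: (hQ v1 m1 _ x) => //; [lia | rewrite -ej | rewrite /=; lia].
have {jw} jw : j < w by lia.
have {}xY : x <= Y0.
  rewrite leqNgt; apply/negP => lt; have ex : x = Y0.+1 by lia.
  by move: w_count; rewrite -ex -size_filter -hps size_mkseq; lia.
have x_W : x + 2 < wsize W.
  by apply: leq_ltn_trans W_Y0; apply: leq_trans (leq_pmulr _ _); lia.
have xx : (x + 1) * (x + 1) <= (Y0 + 2) * (Y0 + 2) by apply: leq_mul; lia.
have er : Y0.+1 - x = (Y0.+1 - x.+1).+1 by lia.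
rewrite er mulnS in hT1.
pose rest := (100 + 50 * r) * (Y0.+1 - x.+1).
rewrite -/rest in hT1.
have fuel y : y = x.+1 -> 40 + rest + R = 40 + (100 + 50 * r) * (Y0.+1 - y) + R by move=> ->.
clearbody rest.
do 2 (wstep; side).
pose J (st : state) T' := exists d,
  [/\ env cst st.1, st.1 27 = x, st.1 28 = j & st.2 = m1] /\
  [/\ st.1 29 = d, st.1 30 = no_divisor x d, 2 <= d,
     d = 2 \/ x < n /\ (d - 1) * (d - 1) <= x &
     100 + 50 * (r - d) + rest + R <= T'].
apply: wp_seq; apply: (wp_while (I := J)); last first.
  exists 2; split; split=> //=; try lia; first envs.
move=> [v2 m2] T2 [d [[hv2 F27 F28 /= em] [F29 F30 d2 hd hT2]]]; subst m2.
rewrite /= in hv2 F27 F28 F29 F30.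
have {}Ew := hv2 1 isT; have {}En := hv2 6 isT; have {}EP := hv2 13 isT.
rewrite /= in Ew En EP.
have dd : d * d < wsize W.
  case: hd => [->|[_ hd]]; first lia.
  apply: leq_ltn_trans W_Y0; apply: leq_trans xx.
  have d1 : d - 1 <= (d - 1) * (d - 1) by rewrite leq_pmulr //; lia.
  by apply: leq_mul; lia.
clear W_Y0 xx er hT.
split.
- rewrite /=; regs v2; by move: (d * d < x + 1) (x < n) => [] []; repeat split=> //; lia.
- rewrite /=; lia.
- rewrite /=; regs v2 => hc2.
  have [dx xn] : d * d <= x /\ x < n by move: hc2; case: ltnP; case: ltnP; lia.
  have d_x : d <= x by apply: leq_trans dx; rewrite leq_pmulr //; lia.
  have dr : d < r by rewrite ltnNge; apply/negP => rd; have := leq_mul rd rd; lia.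
  apply: wp_seq; apply: wp_if; rewrite /=; regs v2.
  + repeat split=> //; apply: leq_ltn_trans (leq_mod _ _) _; lia.
  + lia.
  + move=> hm; apply: wp_skip; wstep; regs v2; try lia; first by repeat split; lia.
    exists d.+1; split; split=> //=; try lia; first envs.
    * by rewrite F30 no_divisorS // /dvdn; move/eqP: hm => ->; rewrite andbT.
  + move=> hm; wstep; side; wstep; regs v2; try lia; first by repeat split; lia.
    exists d.+1; split; split=> //=; try lia; first envs.
    * by rewrite no_divisorS // /dvdn hm eqxx andbF.
- rewrite /=; regs v2 => hc2.
  have hx : n <= x \/ x < d * d by move: hc2; case: ltnP; case: ltnP; lia.
  have hg := no_divisor_good x2 d2 hd hx.
  have ei : index_iota 2 x.+1 = rcons (index_iota 2 x) x.
    by rewrite /index_iota subSn // -[(x - 2).+1]addn1 iotaD subnKC // cats1.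
  have fin v' m' T' j' : env cst v' -> v' 27 = x + 1 -> v' 28 = j' -> j' <= w ->
      (forall q, q < P -> m' q = m q) ->
      mkseq (fun q => m' (P + q)) j' = [seq p <- index_iota 2 x.+1 | good_modulus n p] ->
      40 + rest + R <= T' -> Inv (v', m') T'.
    move=> hv' ev' ej' jw' hf' hps' hT'; exists x.+1, j'; split; split=> //=; try lia.
    by rewrite -(fuel _ (erefl _)).
  apply: wp_seq; apply: wp_if; rewrite /=; regs v2; rewrite ?hg; [by [] | lia | | ].
    move=> hgm; have {}hgm : good_modulus n x by case: (good_modulus n x) hgm.
    do 2 (wstep; regs v2; try lia; first by repeat split; lia).
    wstep; regs v2; try lia; first by repeat split; lia.
    apply: (fin _ _ _ j.+1) => //=; try lia; first envs.
    * by move=> q qP; rewrite upd_ne ?hf //; lia.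
    * rewrite ei filter_rcons hgm -hps -addn1 /mkseq iotaD map_cat /= add0n upd_eq cats1.
      congr rcons; apply/eq_in_map => q; rewrite mem_iota => /andP[_ qj].
      by rewrite upd_ne //; lia.
  move=> hgm; have {}hgm : good_modulus n x = false by case: (good_modulus n x) hgm.
  apply: wp_skip; wstep; regs v2; try lia; first by repeat split; lia.
  apply: (fin _ _ _ j) => //=; try lia; first envs.
  by rewrite ei filter_rcons hgm.
Qed.

End FindModuli.

Section Codeword.

Variables (n w kp Y : nat) (g ps : nat -> nat).

Definition codeword u j := (g u * w + j) * Y + u %% ps j.

Hypothesis g_lt : forall u, u < n -> g u < kp.
Hypothesis ps_lt : forall j, j < w -> 0 < ps j < Y.

Lemma codeword_lt u j : u < n -> j < w -> codeword u j < kp * w * Y.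
Proof.
move=> un jw; have /andP[p0 pY] := ps_lt jw.
have lt : u %% ps j < Y by apply: leq_trans pY; rewrite ltnS ltnW // ltn_mod.
apply: (@leq_trans ((g u * w + j).+1 * Y)); first by rewrite /codeword mulSn; lia.
rewrite leq_mul2r; apply/orP; right.
apply: (@leq_trans ((g u).+1 * w)); first by rewrite mulSn; lia.
by rewrite leq_mul2r g_lt ?orbT.
Qed.

End Codeword.

Section WriteCode.

Variables (W M z k e n L w kp t H N D P A Y : nat).
Variables (g : nat -> nat) (ps : nat -> nat).

Hypothesis w0 : 0 < w.
Hypothesis AE : A = P + w.
Hypothesis H_P : H + n <= P.
Hypothesis A_M : A + n * w <= M.
Hypothesis M_W : M < wsize W.
Hypothesis W_16 : 16 < wsize W.
Hypothesis W_ell : kp * w * Y < wsize W.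
Hypothesis g_lt : forall u, u < n -> g u < kp.
Hypothesis ps_lt : forall j, j < w -> 0 < ps j < Y.

Implicit Types (Q : state -> nat -> Prop).

Let cst := [:: 0; w; A; z; k; e; n; L; t; kp; H; N; D; P].

Lemma write_code_wp Q v m T :
  env cst v -> v 27 = Y -> 50 * (n * w) + 60 <= T ->
  (forall u, u < n -> m (H + u) = g u) -> (forall j, j < w -> m (P + j) = ps j) ->
  (forall v' m' T', v' 0 = kp * w * Y -> v' 1 = w -> v' 2 = A ->
     (forall x, x < n * w -> m' (A + x) = codeword w Y g ps (x %/ w) (x %% w)) ->
     Q (v', m') T') ->
  wp W M write_code (v, m) T Q.
Proof.
move=> hv EY hT hg hp hQ; rewrite /write_code.
wstep; side.
pose Inv (st : state) T' := exists x,
  [/\ env cst st.1, st.1 27 = Y, st.1 26 = x & x <= n * w] /\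
  [/\ forall q, q < A -> st.2 q = m q,
      forall q, q < x -> st.2 (A + q) = codeword w Y g ps (q %/ w) (q %% w) &
      30 + 50 * (n * w - x) <= T'].
apply: wp_seq; apply: (wp_while (I := Inv)); last first.
  by exists 0; split; split=> //=; try lia; envs.
move=> [v1 m1] T1 [x [[hv1 E27 E26 xw] [hf hc hT1]]].
rewrite /= in hv1 E27 E26 hf hc.
have Ew := hv1 1 isT; have EA := hv1 2 isT; have En := hv1 6 isT.
have EP := hv1 13 isT; have EH := hv1 10 isT; have Ek := hv1 9 isT.
rewrite /= in Ew En EP EA EH Ek.
have [nw enw] : exists nw, nw = n * w by eexists.
have nw_W : nw < wsize W by lia.
rewrite -enw in xw hT1.
split; [| rewrite /=; lia | |]; rewrite /=; regs v1; rewrite -?enw.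
- by repeat split=> //; move: (x < nw) => []; lia.
- move=> hx; have {hx} xn : x < nw by lia.
  have [u eu] : exists u, u = x %/ w by eexists.
  have [j ej] : exists j, j = x %% w by eexists.
  have jw : j < w by rewrite ej ltn_mod.
  have un : u < n by rewrite eu ltn_divLR // -enw.
  have e1 : m1 (H + u) = g u by rewrite hf ?hg //; lia.
  have e2 : m1 (P + j) = ps j by rewrite hf ?hp //; lia.
  have cl := codeword_lt g_lt ps_lt un jw.
  have := ps_lt jw; have := g_lt un; move=> gk /andP[p0 pY].
  have c1 : g u * w + j <= (g u * w + j) * Y by rewrite leq_pmulr //; lia.
  have ml : u %% ps j <= u by apply: leq_mod.
  have xA : A + x < M by lia.
  have jA : P + j < M by lia.
  have uA : H + u < M by lia.
  wstep; regs v1; rewrite -?eu -?ej ?e1 ?e2 -/(codeword w Y g ps u j).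
  + repeat split=> //; lia.
  + rewrite /codeword in cl *; repeat split=> //; lia.
  + by [].
  + lia.
  wstep; regs v1; try lia; first by repeat split; lia.
  exists (x + 1); split; split=> //=; try lia; first envs.
  + by move=> q qA; rewrite upd_ne ?hf //; lia.
  + move=> q; rewrite addn1 ltnS leq_eqVlt => /orP[/eqP ->|qx].
      by rewrite upd_eq -eu -ej.
    by rewrite upd_ne ?hc //; lia.
- move=> hx; have ex : x = nw by lia.
  have kw : kp * w <= kp * w * Y.
    by have /andP[] := ps_lt w0; case: (Y) => // Y' *; rewrite leq_pmulr.
  wstep; regs v1; try lia; first by repeat split; lia.
  by apply: hQ => //= q; rewrite -enw -ex; apply: hc.
Qed.

End WriteCode.

Section Prologue.

Variables (W M z k e n L w lk kp t H N D P A : nat) (m0 : nat -> nat).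

Hypothesis z0 : 0 < z.
Hypothesis k0 : 0 < k.
Hypothesis nE : n = z * k.
Hypothesis L0 : 0 < L.
Hypothesis n_lt : n < 2 ^ L.
Hypothesis n_ge : 2 ^ L.-1 <= n.
Hypothesis wE : w = e * L * (L + 3).
Hypothesis kpE : kp = 2 ^ lk.
Hypothesis kp_ge : 2 * k <= kp.
Hypothesis kp_lt : kp < 4 * k.
Hypothesis HE : H = 3 + z + n.
Hypothesis NE : N = H + n.
Hypothesis DE : D = N + 2 * n.
Hypothesis PE : P = D + z * (2 * kp).
Hypothesis AE : A = P + w.
Hypothesis tE : t = 2 ^ L.
Hypothesis A_M : A <= M.
Hypothesis M_W : M < wsize W.
Hypothesis W_16 : 16 < wsize W.
Hypothesis m0z : m0 0 = z.
Hypothesis m0k : m0 1 = k.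
Hypothesis m0e : m0 2 = e.

Lemma prologue_wp (Q : state -> nat -> Prop) T R :
  200 + 50 * (L + lk) + R <= T ->
  (forall v T', env [:: 0; w; A; z; k; e; n; L; t; kp; H; N; D; P] v ->
     R <= T' -> Q (v, m0) T') ->
  wp W M prologue (fun=> 0, m0) T Q.
Proof.
move=> hT hQ; rewrite /prologue.
have [z2 ez2] : exists z2, z2 = z * (2 * kp) by eexists.
have [el eel] : exists el, el = e * L by eexists.
have el_w : el <= w by rewrite wE eel leq_pmulr //; lia.
have t_n : t <= 2 * n by rewrite tE -(prednK L0) expnS leq_mul2l.
have kp_P : 2 * kp <= P.
  by rewrite PE; apply: leq_trans (leq_addl _ _); rewrite leq_pmull.
have LW : L + 3 <= w \/ w = 0.
  case: (posnP e) => [e0|e0]; [right | left]; rewrite wE ?e0 //.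
  by rewrite leq_pmull // muln_gt0 e0.
have L_n : L <= n by apply: leq_trans n_ge; rewrite -{1}(prednK L0) ltn_expl.
have e_w : e <= el by rewrite eel leq_pmulr.
do 6 (wstep; rewrite ?m0z ?m0k ?m0e -?nE; try lia; try by repeat split; lia).
pose base (v : nat -> nat) := [/\ v 0 = 0, v 3 = z, v 4 = k, v 5 = e & v 6 = n].
pose Inv (st : state) T' := exists q,
  [/\ base st.1, st.1 7 = q & st.1 8 = 2 ^ q] /\
  [/\ st.2 = m0, 0 < q, q <= L & 100 + 50 * (L - q + lk) + R <= T'].
apply: wp_seq; apply: (wp_while (I := Inv)); last first.
  by exists 1; split; split=> //=; lia.
move=> [v1 m1] T1 [q [[[E0 E3 E4 E5 E6] E7 E8] [/= em q0 qL hT1]]]; subst m1.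
rewrite /= in E0 E3 E4 E5 E6 E7 E8.
split; [| rewrite /=; lia | |]; rewrite /=; regs v1.
- by move: (2 ^ q < n + 1) => []; repeat split=> //; lia.
- move=> hc; have {hc} hc : 2 ^ q <= n by lia.
  have qlt : q < L by rewrite -(ltn_exp2l (m := 2)) //; apply: leq_ltn_trans hc _.
  do 2 (wstep; regs v1; try lia; first by repeat split; lia).
  exists q.+1; split; split=> //=; try lia; rewrite ?expnS; lia.
move=> hc; have {hc} hc : n < 2 ^ q by lia.
have eq : q = L.
  apply/eqP; rewrite eqn_leq qL /=.
  have : 2 ^ L.-1 < 2 ^ q by apply: leq_ltn_trans n_ge hc.
  by rewrite ltn_exp2l // -ltnS prednK.
rewrite eq in E7 E8 hT1.
have pw : el <= w by [].
wstep; regs v1; rewrite -?eel -?wE; try lia; first by repeat split; lia.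
wstep; side.
pose J (st : state) T' := exists q,
  [/\ base st.1, st.1 1 = w, st.1 7 = L, st.1 8 = t & st.1 9 = 2 ^ q] /\
  [/\ st.2 = m0, q <= lk & 80 + 50 * (lk - q) + R <= T'].
apply: wp_seq; apply: (wp_while (I := J)); last first.
  by exists 0; split; split=> //=; lia.
move=> [v2 m2] T2 [q' [[[F0 F3 F4 F5 F6] F1 F7 F8 F9] [/= em q'lk hT2]]]; subst m2.
rewrite /= in F0 F3 F4 F5 F6 F1 F7 F8 F9.
split; [| rewrite /=; lia | |]; rewrite /=; regs v2.
- by move: (2 ^ q' < 2 * k) => []; repeat split=> //; lia.
- move=> hc3; have {hc3} hc3 : 2 ^ q' < 2 * k by lia.
  have qlt : q' < lk by rewrite -(ltn_exp2l (m := 2)) // -kpE; apply: leq_trans hc3 _.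
  wstep; regs v2; try lia; first by repeat split; lia.
  by exists q'.+1; split; split=> //=; try lia; rewrite ?expnS; lia.
move=> hc3; have {hc3} hc3 : 2 * k <= 2 ^ q' by lia.
have eq' : 2 ^ q' = kp.
  rewrite kpE; congr (2 ^ _); apply/eqP; rewrite eqn_leq q'lk /=.
  have : 2 ^ lk < 2 ^ q'.+1 by rewrite expnS -kpE; lia.
  by rewrite ltn_exp2l.
rewrite eq' in F9.
do 3 (wstep; regs v2; try lia; first by repeat split; lia).
do 2 (wstep; regs v2; rewrite -?ez2; try lia; first by repeat split; lia).
apply: hQ; last lia.
move=> x; do 14 (case: x => [_|x] /=; first by regs v2; lia).
by [].
Qed.

End Prologue.

Lemma wp_run W M c input T Q : wp W M c (fun=> 0, fun a => nth 0 input a) T Q ->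
  size input <= M ->
  exists s T' cf, [/\ runs_within W (compile 0 c) input T M cf, Q s T',
    forall x, x < nvars -> regs cf x = s.1 x & Defs.mem cf = s.2].
Proof.
move=> h sM; have [||t [T' [r [s [le [hrun hacc] hr hQ]]]]] := h (compile 0 c) 0 (fun=> 0).
- by move=> i _; rewrite add0n.
- by [].
pose cf := Config (csize c) r s.2.
have hcf : halted (compile 0 c) cf by rewrite /halted /= size_compile.
have stop d : iter d (step W (compile 0 c)) cf = cf.
  by elim: d => //= d ->; rewrite /step onth_default.
have e d : iter (d + t) (step W (compile 0 c)) (init input) = cf.
  by rewrite iterD [iter t _ _]hrun add0n stop.
exists s, T', cf; split=> //; split=> //.
  by rewrite -(subnK (leq_trans (leq_addr _ _) le)) e.
move=> t' a _; case: (ltnP t' t) => [lt|ge]; first exact: hacc.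
by rewrite -(subnK ge) e /accessed onth_default.
Qed.

Lemma weight_le e L : 0 < L -> e * L * (L + 3) <= 4 * (e * L ^ 2).
Proof.
move=> L0; rewrite (_ : 4 * (e * L ^ 2) = e * L * (4 * L)); last by rewrite -mulnn; lia.
by rewrite leq_mul2l; apply/orP; right; lia.
Qed.

Section Construction.

Variables (W z k e n L w : nat) (l : nat -> seq nat) (input : seq nat).
Let m0 a := nth 0 input a.

Hypothesis z0 : 0 < z.
Hypothesis k0 : 0 < k.
Hypothesis e0 : 0 < e.
Hypothesis nE : n = z * k.
Hypothesis L0 : 0 < L.
Hypothesis n_lt : n < 2 ^ L.
Hypothesis n_ge : 2 ^ L.-1 <= n.
Hypothesis wE : w = e * L * (L + 3).
Hypothesis l_uniq : forall i, i < z -> uniq (l i).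
Hypothesis l_size : forall i, i < z -> size (l i) <= k.
Hypothesis l_lt : forall i u, i < z -> u \in l i -> u < n.
Hypothesis size_input : size input <= 3 + z + n.
Hypothesis m0z : m0 0 = z.
Hypothesis m0k : m0 1 = k.
Hypothesis m0e : m0 2 = e.
Hypothesis m0_size : forall i, i < z -> m0 (3 + i) = size (l i).
Hypothesis m0_elem : forall i j, i < z -> j < size (l i) ->
  m0 (3 + z + off l i + j) = nth 0 (l i) j.
Hypothesis word_large : forall c d, c <= 512 -> d <= 6 -> c * (n * e) ^ d < 2 ^ W.

Lemma n_gt0 : 0 < n. Proof. by rewrite nE muln_gt0 z0. Qed.

Lemma L_le_n : L <= n.
Proof. by apply: leq_trans n_ge; rewrite -{1}(prednK L0) ltn_expl. Qed.

Lemma sqrt_bound : exists r, n <= r * r /\ 0 < r /\ r * L <= 8 * n.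
Proof.
pose h := (L.+1)./2; have hL : L <= 2 * h <= L.+1 by rewrite /h; lia.
have h0 : 0 < h by rewrite /h; lia.
exists (2 ^ h); rewrite expn_gt0 -expnD addnn -mul2n; split; [|split=> //].
  by apply: leq_trans (ltnW n_lt) _; rewrite leq_exp2l //; lia.
have h1 : 2 ^ (2 * h - 2) <= n.
  by apply: leq_trans n_ge; rewrite leq_exp2l //; lia.
apply: (@leq_trans (2 ^ h * (2 * h))); first by rewrite leq_mul2l; apply/orP; right; lia.
apply: (@leq_trans (2 ^ h * (2 * 2 ^ h))).
  by rewrite !leq_mul2l ltnW ?orbT // ltn_expl.
rewrite mulnCA -expnD addnn -mul2n (_ : 2 * h = (2 * h - 2) + 2); last lia.
by rewrite expnD; lia.
Qed.

Lemma bucket_exponent : exists lk, [/\ 2 * k <= 2 ^ lk, 2 ^ lk < 4 * k & lk <= L + 1].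
Proof.
exists (up_log 2 (2 * k)).
have k21 : 1 < 2 * k by lia.
have h1 := up_logP (2 * k) (isT : 1 < 2).
have h2 := up_log_gtn (isT : 1 < 2) k21.
have h0 : 0 < up_log 2 (2 * k) by rewrite up_log_gt0.
have h3 : 2 ^ up_log 2 (2 * k) < 4 * k.
  by rewrite -(prednK h0) expnS; lia.
split=> //; have : 2 ^ up_log 2 (2 * k) < 2 ^ (L + 2).
  apply: leq_trans h3 _; rewrite expnD mulnC leq_mul2r /=.
  by apply: leq_trans (ltnW n_lt); rewrite nE leq_pmull.
by rewrite ltn_exp2l //; lia.
Qed.

Definition final_memory kp := 3 + z + n + n + 2 * n + z * (2 * kp) + w + n * w.

Lemma w_le : w <= 4 * (e * L ^ 2).
Proof. by rewrite wE; apply: weight_le. Qed.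

Lemma final_memory_le kp : kp < 4 * k -> final_memory kp <= 24 * (e * n * L ^ 2).
Proof.
move=> kp_lt; have n0 := n_gt0.
have zn : z <= n by rewrite nE leq_pmulr.
have zk : z * (2 * kp) <= 8 * n.
  by rewrite nE (_ : 8 * (z * k) = z * (8 * k)) ?leq_mul2l; [apply/orP; right|]; lia.
have L2 : 0 < e * L ^ 2 by rewrite muln_gt0 e0 expn_gt0 L0.
have nU : n <= n * (e * L ^ 2) by rewrite leq_pmulr.
have wU : w + n * w <= 8 * (n * (e * L ^ 2)).
  have := w_le; have : w <= n * w by rewrite leq_pmull.
  have : n * w <= n * (4 * (e * L ^ 2)) by rewrite leq_mul2l w_le orbT.
  lia.
rewrite /final_memory (_ : e * n * L ^ 2 = n * (e * L ^ 2)); last by rewrite mulnCA mulnA.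
by move: (n * (e * L ^ 2)) (n * w) (z * (2 * kp)) nU wU zk => U nw zk' nU wU zk; lia.
Qed.

Lemma running_time_le lk r : lk <= L + 1 -> 0 < r -> r * L <= 8 * n ->
  1000 + 50 * (L + lk) + 100 * (z + n + 1) + 300 * ((lk + 1) * (2 * n)) +
    (100 + 50 * r) * (16 * e * L ^ 3) + 50 * (n * w) <= 10 * 2500 * (e * n * L ^ 2).
Proof.
move=> lkL r0 rL; have n0 := n_gt0; have Ln := L_le_n.
have zn : z <= n by rewrite nE leq_pmulr.
rewrite (_ : e * n * L ^ 2 = n * (e * L ^ 2)); last by rewrite mulnCA mulnA.
have L2 : 0 < e * L ^ 2 by rewrite muln_gt0 e0 expn_gt0 L0.
have nU : n <= n * (e * L ^ 2) by rewrite leq_pmulr.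
have nL : n * L <= n * (e * L ^ 2).
  by rewrite leq_mul2l -mulnn mulnA leq_pmull ?orbT // muln_gt0 e0 L0.
have nw : n * w <= 4 * (n * (e * L ^ 2)).
  by rewrite (_ : 4 * (n * (e * L ^ 2)) = n * (4 * (e * L ^ 2))) ?leq_mul2l ?w_le ?orbT //; lia.
have lkn : (lk + 1) * (2 * n) <= 6 * (n * L).
  rewrite (_ : 6 * (n * L) = (3 * L) * (2 * n)); last lia.
  by rewrite leq_mul2r; apply/orP; right; lia.
have hr : (100 + 50 * r) * (16 * e * L ^ 3) <= 8 * 2400 * (n * (e * L ^ 2)).
  apply: (@leq_trans (2400 * ((r * L) * (e * L ^ 2)))).
    rewrite (_ : 2400 * ((r * L) * (e * L ^ 2)) = (150 * r) * (16 * e * L ^ 3)).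
      by rewrite leq_mul2r; apply/orP; right; lia.
    by rewrite [L ^ 3]expnS; lia.
  rewrite (_ : 8 * 2400 * (n * (e * L ^ 2)) = 2400 * ((8 * n) * (e * L ^ 2))); last lia.
  by rewrite !leq_mul2l leq_mul2r rL !orbT.
by move: (n * (e * L ^ 2)) ((lk + 1) * (2 * n)) ((100 + 50 * r) * _) (n * w) (n * L) nU nL nw lkn hr
  => U x1 x2 x3 x4 nU nL nw lkn hr; lia.
Qed.

Lemma lists_balanced H N D m kp lk : kp = 2 ^ lk ->
  lists_inv n H N D m0 n (revadj l z) m -> N + 2 * n = D ->
  balanced z k n lk kp H N D l 0 (fun=> 0) m.
Proof.
move=> kpE [h1 h2 h3] ND; split=> //; last by rewrite pot0.
- by move=> u /andP[_ un]; rewrite -{1}ND; apply: h3.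
- have s0 i : seen l i 0 = 0 by rewrite /seen (eq_count (a2 := xpred0)) // count_pred0.
  have c0 i x : cell kp D m i x = 0 by rewrite /cell h2 //; lia.
  move=> i iz; split=> [|y _|b _]; rewrite ?c0 ?s0 //.
  by rewrite /load (eq_count (a2 := xpred0)) // count_pred0.
Qed.

Lemma construction_run : exists kp Y g ps T M cf,
  [/\ runs_within W (compile 0 construction) input T M cf,
      [/\ 2 <= Y <= (16 * e * L ^ 3).+1,
          mkseq ps w = [seq p <- index_iota 2 Y | good_modulus n p],
          forall u, u < n -> g u < kp &
          pot z k kp l g n <= z * (2 * k * kp)],
      [/\ regs cf 0 = kp * w * Y, regs cf 1 = w, regs cf 2 + n * w <= M &
         forall x, x < n * w ->
           Defs.mem cf (regs cf 2 + x) = codeword w Y g ps (x %/ w) (x %% w)] &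
      [/\ kp < 4 * k, M <= 24 * (e * n * L ^ 2) & T <= 10 * 2500 * (e * n * L ^ 2)]].
Proof.
have [lk [kp_ge kp_lt lk_le]] := bucket_exponent.
have [r [r_sq [r0 rL]]] := sqrt_bound.
pose kp := 2 ^ lk; pose M := final_memory kp.
pose Y0 := 16 * e * L ^ 3.
pose T := 1000 + 50 * (L + lk) + 100 * (z + n + 1) + 300 * ((lk + 1) * (2 * n)) +
  (100 + 50 * r) * Y0 + 50 * (n * w).
have [H HE] : exists H, H = 3 + z + n by eexists.
have [N NE] : exists N, N = H + n by eexists.
have [D DE] : exists D, D = N + 2 * n by eexists.
have [P PE] : exists P, P = D + z * (2 * kp) by eexists.
have [A AE] : exists A, A = P + w by eexists.
have A_M : M = A + n * w by rewrite /M /final_memory AE PE DE NE HE; lia.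
have n0 := n_gt0; have Ln := L_le_n.
have nX : n <= n * e by rewrite leq_pmulr.
have eX : e <= n * e by rewrite leq_pmull.
have kn : k <= n by rewrite nE leq_pmull.
have eLX i : e * L ^ i.+1 <= (n * e) ^ i.+1.
  rewrite expnMn mulnC; apply: leq_mul; first exact: leq_exp2rW.
  by rewrite -{1}(expn1 e) leq_pexp2l.
have M_W : M < wsize W.
  apply: leq_ltn_trans (final_memory_le kp_lt) _.
  apply: leq_ltn_trans (word_large (c := 24) (d := 3) isT isT).
  rewrite leq_mul2l /= (_ : e * n * L ^ 2 = n * (e * L ^ 2)); last by rewrite mulnCA mulnA.
  by rewrite [(n * e) ^ 3]expnS leq_mul.
have W_16 : 16 < wsize W.
  exact: (word_large (c := 16) (d := 0) isT isT).
have W_pot : 2 * (z * (2 * k * kp)) + 2 < wsize W.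
  apply: leq_ltn_trans (word_large (c := 18) (d := 2) isT isT).
  have h : n * kp <= 4 * (n * n) by rewrite [leqRHS]mulnCA leq_mul2l; apply/orP; right; lia.
  have h2 : n * n <= (n * e) ^ 2 by rewrite -mulnn leq_mul.
  have h3 : z * (2 * k * kp) = 2 * (n * kp) by rewrite nE; lia.
  have h4 : 0 < n * n by rewrite muln_gt0 n0.
  rewrite h3; move: (n * kp) (n * n) ((n * e) ^ 2) h h2 h4 => a b c; lia.
have W_Y0 : (Y0 + 2) * (Y0 + 2) < wsize W.
  apply: leq_ltn_trans (word_large (c := 324) (d := 6) isT isT).
  have X1 : 0 < (n * e) ^ 3 by rewrite expn_gt0 muln_gt0 n0 e0.
  have h : Y0 + 2 <= 18 * (n * e) ^ 3 by have := eLX 2; rewrite /Y0 -mulnA; lia.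
  by apply: leq_trans (leq_mul h h) _; rewrite mulnACA -expnD.
have W_ell Y : Y <= Y0.+1 -> kp * w * Y < wsize W.
  move=> hY; apply: leq_ltn_trans (word_large (c := 272) (d := 6) isT isT).
  have h1 : kp <= 4 * (n * e) by lia.
  have h2 : w <= 4 * (n * e) ^ 2 by apply: leq_trans w_le _; rewrite leq_mul2l eLX orbT.
  have X1 : 0 < (n * e) ^ 3 by rewrite expn_gt0 muln_gt0 n0 e0.
  have h3 : Y <= 17 * (n * e) ^ 3 by have := eLX 2; move: hY; rewrite /Y0 -mulnA; lia.
  apply: leq_trans (leq_mul (leq_mul h1 h2) h3) _.
  by rewrite [4 * (n * e) * _]mulnACA -expnS mulnACA -expnD.
have w0 : 0 < w by rewrite wE !muln_gt0 e0 L0 addn3.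
have off_n : off l z <= n.
  rewrite nE -(subn0 z) -sum_nat_const_nat subn0 /off big_nat [leqRHS]big_nat.
  by apply: leq_sum => i /andP[_ /l_size].
have sum_n : \sum_(0 <= u < n) (1 + size (adj z l u)) <= 2 * n.
  rewrite big_split /= sum_nat_const_nat subn0 muln1 mul2n -addnn leq_add2l.
  exact: leq_trans (sum_size_adj l_lt) off_n.
have w_cnt : w <= count (good_modulus n) (index_iota 2 Y0.+1).
  by rewrite wE; apply: count_good_moduli.
have m0_0 x : H <= x -> m0 x = 0.
  by move=> Hx; apply: nth_default; apply: leq_trans size_input _; rewrite -HE.
pose cst := [:: 0; w; A; z; k; e; n; L; 2 ^ L; kp; H; N; D; P].
pose Post (s : state) (T' : nat) := exists Y g ps,
  [/\ 2 <= Y <= Y0.+1,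
    mkseq ps w = [seq p <- index_iota 2 Y | good_modulus n p],
    forall u, u < n -> g u < kp & pot z k kp l g n <= z * (2 * k * kp)] /\
  [/\ s.1 0 = kp * w * Y, s.1 1 = w, s.1 2 = A &
    forall x, x < n * w -> s.2 (A + x) = codeword w Y g ps (x %/ w) (x %% w)].
have [||s [T' [cf [hrun [Y [g [ps [hps [s0 s1 s2 hc]]]]] hregs hmem]]]] :=
    wp_run (W := W) (M := M) (c := construction) (input := input) (T := T) (Q := Post).
- rewrite /construction.
  pose R4 := 50 * (n * w) + 60.
  pose R3 := 60 + (100 + 50 * r) * Y0 + R4.
  pose R2 := 50 + 300 * ((lk + 1) * (2 * n)) + R3.
  pose R1 := 100 * (z + n + 1) + R2.
  apply: wp_seq.
  apply: (prologue_wp (w := w) (lk := lk) z0 k0 nE L0 n_lt n_ge wE (erefl kp) kp_ge kp_lt HE NE DE PE AE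
    (erefl (2 ^ L)) _ M_W W_16 m0z m0k m0e (R := R1)).
  + by rewrite A_M leq_addr.
  + by rewrite /R1 /R2 /R3 /R4 /T; lia.
  move=> v1 T1 hv1 hT1; apply: wp_seq.
  apply: (build_lists_wp HE NE DE _ M_W W_16 l_uniq l_lt off_n m0_size m0_elem m0_0 hv1 (R := R2)) => //.
    by rewrite A_M AE PE; lia.
  move=> v2 m2 T2 hv2 hl2 hT2; apply: wp_seq.
  apply: (balance_wp z0 k0 (erefl kp) kp_ge NE _ _ PE _ M_W W_16 W_pot l_uniq l_size hv2
    (lists_balanced (erefl kp) hl2 (esym DE)) (R := R3)).
  + by rewrite DE; lia.
  + by rewrite NE HE; lia.
  + by rewrite A_M AE; lia.
  + apply: leq_trans hT2; rewrite /R2 leq_add2r leq_add2l leq_mul2l /=.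
    by rewrite leq_mul2l sum_n orbT.
  move=> v3 m3 T3 g hv3 [hg _ _ hpot] hT3; apply: wp_seq.
  apply: (find_moduli_wp w0 w_cnt r_sq _ M_W W_16 W_Y0 _ hv3 (R := R4)).
  + by rewrite A_M AE leq_addr.
  + by rewrite A_M AE PE DE NE HE; lia.
  + by [].
  move=> v4 m4 T4 Y hv4 EY hY hf hps hT4.
  apply: (write_code_wp (g := g) (ps := fun q => m4 (P + q)) w0 AE _ _ M_W W_16
     (W_ell Y _) _ _ hv4 EY hT4).
  + by rewrite PE DE NE; lia.
  + by rewrite A_M.
  + by case/andP: hY.
  + by move=> u un; have [] := hg u un.
  + move=> j jw.
    have : m4 (P + j) \in mkseq (fun q => m4 (P + q)) w by apply: map_f; rewrite mem_iota.
    by rewrite hps mem_filter mem_index_iota => /andP[_ /andP[? ->]]; rewrite andbT; lia.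
  + move=> u un; have [<- _] := hg u un; apply: hf; rewrite PE DE NE; lia.
  + by [].
  move=> v5 m5 T5 E0 E1 E2 hc; exists Y, g, (fun q => m4 (P + q)); split; split=> //.
  by move=> u un; have [] := hg u un.
- by rewrite A_M AE PE DE NE HE; lia.
exists kp, Y, g, ps, T, M, cf; split=> //.
  by rewrite !hregs // hmem s0 s1 s2 A_M.
by split=> //; [exact: final_memory_le | exact: running_time_le].
Qed.

End Construction.

(** * The code *)

Lemma perm_enum_seq ell (s : seq nat) : uniq s -> all (fun x => x < ell) s ->
  perm_eq [seq val x | x in [set x : 'I_ell | val x \in s]] s.
Proof.
move=> us /allP ls; apply: uniq_perm => //.
  by rewrite map_inj_uniq ?enum_uniq //; exact: val_inj.
move=> y; apply/mapP/idP => [[x + ->]|ys]; first by rewrite mem_enum inE.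
by exists (Ordinal (ls y ys)); rewrite // mem_enum inE.
Qed.

Lemma card_enum_seq ell (s : seq nat) : uniq s -> all (fun x => x < ell) s ->
  #|[set x : 'I_ell | val x \in s]| = size s.
Proof. by move=> us ls; rewrite -(perm_size (perm_enum_seq us ls)) size_map -cardE. Qed.

Lemma count_has (T S : Type) (r : T -> S -> bool) s t :
  count (fun x => has (r x) s) t <= \sum_(y <- s) count (fun x => r x y) t.
Proof.
elim: s => [|y s IH]; first by rewrite big_nil count_pred0.
rewrite big_cons; apply: leq_trans (leq_add (leqnn _) IH).
by rewrite -count_predUI; apply: leq_addr.
Qed.

Section Separation.

Variables (n L w Y : nat) (g ps : nat -> nat).

Hypothesis psE : mkseq ps w = [seq p <- index_iota 2 Y | good_modulus n p].

Definition row u := mkseq (codeword w Y g ps u) w.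

Lemma ps_lt j : j < w -> 1 < ps j < Y.
Proof.
move=> jw; have : ps j \in mkseq ps w by apply: map_f; rewrite mem_iota.
by rewrite psE mem_filter mem_index_iota => /andP[].
Qed.

Lemma codeword_inj u v i j : i < w -> j < w ->
  codeword w Y g ps u i = codeword w Y g ps v j ->
  [/\ g u = g v, i = j & u %% ps i = v %% ps j].
Proof.
move=> iw jw; have /andP[i1 iY] := ps_lt iw; have /andP[j1 jY] := ps_lt jw.
have Y0 : 0 < Y by lia.
have ui : u %% ps i < Y by apply: ltn_trans iY; rewrite ltn_mod; lia.
have vj : v %% ps j < Y by apply: ltn_trans jY; rewrite ltn_mod; lia.
have w0 : 0 < w by lia.
rewrite /codeword => h.
have e1 : g u * w + i = g v * w + j.
  by have := congr1 (divn^~ Y) h; rewrite /= !divnMDl // !divn_small // !addn0.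
split.
- by have := congr1 (divn^~ w) e1; rewrite /= !divnMDl // !divn_small // !addn0.
- by have := congr1 (modn^~ w) e1; rewrite /= !modnMDl !modn_small.
- by have := congr1 (modn^~ Y) h; rewrite /= !modnMDl (modn_small ui) (modn_small vj).
Qed.

Lemma row_uniq u : uniq (row u).
Proof.
rewrite map_inj_in_uniq ?iota_uniq // => i j.
by rewrite !mem_iota => /andP[_ iw] /andP[_ jw] /(codeword_inj iw jw)[].
Qed.

Hypothesis L0 : 0 < L.
Hypothesis n_lt : n < 2 ^ L.

Lemma row_collisions u s : u < n -> all (fun v => v < n) s -> u \notin s ->
  count (fun x => has (fun v => x \in row v) s) (row u) <=
  count (fun v => g v == g u) s * L.
Proof.
move=> un /allP sn us.
apply: (@leq_trans (count (fun j => has (fun v => u %% ps j == v %% ps j)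
    [seq v <- s | g v == g u]) (iota 0 w))).
  rewrite count_map -!size_filter; apply: uniq_leq_size.
    by rewrite filter_uniq ?iota_uniq.
  move=> j; rewrite !mem_filter mem_iota => /andP[/hasP[v vs /mapP[j']]].
  rewrite mem_iota => /andP[_ jw'] h /andP[_ jw]; apply/andP; split=> //; apply/hasP.
  have [e1 e2 e3] := codeword_inj jw jw' h.
  by exists v; [rewrite mem_filter vs e1 eqxx | rewrite e3 e2].
apply: leq_trans (count_has _ _ _) _.
rewrite big_filter -sum1_count big_distrl /= big_seq_cond [leqRHS]big_seq_cond.
apply: leq_sum => v /andP[vs _]; rewrite mul1n.
rewrite -(count_map ps (fun p => u %% p == v %% p)) -/(mkseq ps w) psE.
apply: ltnW; apply: collisions_lt (ltnW n_lt) un (sn v vs) _ => //.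
- by rewrite filter_uniq ?iota_uniq.
- by apply: filter_all.
- by apply: contraNneq us => ->.
Qed.

End Separation.

Lemma word_large W X c d : 2 <= X -> X ^ 15 < 2 ^ W -> c <= 512 -> d <= 6 ->
  c * X ^ d < 2 ^ W.
Proof.
move=> X2 hX c9 d6; apply: leq_ltn_trans hX; rewrite -[15]/(9 + 6) expnD.
apply: leq_mul; last by rewrite leq_exp2l.
by apply: leq_trans c9 _; rewrite -[512]/(2 ^ 9) leq_exp2r.
Qed.

Lemma nth_flatten_off (ss : seq (seq nat)) i j : j < size (nth [::] ss i) ->
  nth 0 (flatten ss) (off (nth [::] ss) i + j) = nth 0 (nth [::] ss i) j.
Proof.
elim: ss i => [|s ss IH] [|i] //= h.
  by rewrite /off big_geq // add0n nth_cat h.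
by rewrite /off big_nat_recl //= -/(off _ i) -addnA nth_cat ltnNge leq_addr /= addKn IH.
Qed.

Lemma off_sumn (ss : seq (seq nat)) : off (nth [::] ss) (size ss) = size (flatten ss).
Proof.
elim: ss => [|s ss IH]; first by rewrite /off big_geq.
by rewrite /off big_nat_recl //= size_cat -IH.
Qed.

Section Code.

Variables (W z k e : nat) (U : finType) (S : 'I_z -> {set U}) (Ls : 'I_z -> seq U).
Let n := #|U|.
Let L := (trunc_log 2 n).+1.
Let w := e * L * (L + 3).
Let ranks i := [seq val (enum_rank u) | u <- Ls i].
Let ll := [seq ranks i | i <- enum 'I_z].
Let l := nth [::] ll.

Hypothesis z0 : 0 < z.
Hypothesis k0 : 0 < k.
Hypothesis e1 : 1 < e.
Hypothesis nE : n = z * k.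
Hypothesis S_k : forall i, #|S i| <= k.
Hypothesis Ls_uniq : forall i, uniq (Ls i).
Hypothesis Ls_S : forall i, Ls i =i S i.
Hypothesis W_large : (n * e) ^ 15 < 2 ^ W.

Lemma size_ll : size ll = z.
Proof. by rewrite size_map size_enum_ord. Qed.

Lemma lE i (iz : i < z) : l i = ranks (Ordinal iz).
Proof.
rewrite /l (nth_map (Ordinal iz)) ?size_enum_ord //; congr ranks; apply: val_inj.
by rewrite /= nth_enum_ord.
Qed.

Lemma ranks_uniq i : uniq (ranks i).
Proof.
rewrite map_inj_uniq // => u v h; apply: enum_rank_inj; exact: val_inj.
Qed.

Lemma mem_ranks i u : (val (enum_rank u) \in ranks i) = (u \in S i).
Proof.
rewrite -(Ls_S i); apply: (mem_map (f := fun u => val (enum_rank u))) => v v' h.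
by apply: enum_rank_inj; apply: val_inj.
Qed.

Lemma l_size i : i < z -> size (l i) <= k.
Proof.
move=> iz; rewrite lE size_map -(card_uniqP (Ls_uniq _)) (eq_card (Ls_S _)); exact: S_k.
Qed.

Lemma l_lt i u : i < z -> u \in l i -> u < n.
Proof. by move=> iz; rewrite lE => /mapP[v _ ->]; apply: ltn_ord. Qed.

Lemma input_shape : encode_input k e Ls = [:: z; k; e] ++ shape ll ++ flatten ll.
Proof.
rewrite (_ : shape ll = [seq size (Ls i) | i <- enum 'I_z]) //.
by rewrite /shape -map_comp; apply: eq_map => i; rewrite /= size_map.
Qed.

Lemma code_construction : exists T M ell (C : U -> {set 'I_ell}) cf,
  [/\ runs_within W (compile 0 construction) (encode_input k e Ls) T M cf,
      outputs_code cf M w C,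
      (forall u, #|C u| = w) /\
      (forall i u, u \notin S i ->
         w <= #|C u :\: \bigcup_(v in S i) C v| + L * (L + 3)) &
      [/\ T <= 10 * 2500 * (e * n * L ^ 2), M <= 24 * (e * n * L ^ 2) &
          ell <= 272 * (e ^ 2 * k * L ^ 5)]].
Proof.
have n0 : 0 < n by rewrite nE muln_gt0 z0.
have n_lt : n < 2 ^ L by apply: trunc_log_ltn.
have n_ge : 2 ^ L.-1 <= n by apply: trunc_logP.
have L0 : 0 < L by [].
have e0 : 0 < e by apply: ltnW.
have X2 : 2 <= n * e by rewrite -[2]mul1n leq_mul.
have l_uniq i : i < z -> uniq (l i) by move=> iz; rewrite lE ranks_uniq.
have wE : w = e * L * (L + 3) by [].
have flat_le : size (flatten ll) <= n.
  rewrite -off_sumn size_ll nE -(subn0 z) -sum_nat_const_nat subn0 /off big_nat [leqRHS]big_nat.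
  by apply: leq_sum => i /andP[_ /l_size].
have [|||||||kp [Y [g [ps [T [M [cf [hrun hps hcf [kp_lt hM hT]]]]]]]]] :=
  construction_run (W := W) (input := encode_input k e Ls) z0 k0 e0 nE L0 n_lt n_ge wE
    l_uniq l_size l_lt.
- by rewrite input_shape !size_cat size_map size_ll; move: flat_le; rewrite /=; lia.
- by [].
- by [].
- by [].
- by move=> i iz; rewrite input_shape nth_cat ltnNge leq_addr /= addKn nth_cat size_map size_ll iz nth_shape.
- move=> i j iz jl; rewrite input_shape -!addnA nth_cat ltnNge leq_addr /= addKn.
  rewrite nth_cat size_map size_ll ltnNge leq_addr /= addKn.
  by rewrite nth_flatten_off.
- by move=> c d; apply: word_large X2 W_large.
have [hY hps1 hg hpot] := hps; have [r0 r1 rM hmem] := hcf.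
pose ell := kp * w * Y.
pose rowU (u : U) := row w Y g ps (enum_rank u).
pose C (u : U) : {set 'I_ell} := [set x : 'I_ell | val x \in rowU u].
have row_lt u : all (fun x => x < ell) (rowU u).
  apply/allP => x /mapP[j]; rewrite mem_iota => /andP[_ jw] ->.
  have un : enum_rank u < n by apply: ltn_ord.
  apply: (codeword_lt hg _ un jw) => j' jw'.
  by have /andP[p1 ->] := ps_lt hps1 jw'; rewrite andbT; apply: ltnW.
have row_u u : uniq (rowU u) by apply: (row_uniq g hps1).
exists T, M, ell, C, cf; split=> //.
- split=> // u.
  rewrite perm_sym; apply: perm_trans (perm_enum_seq (row_u u) (row_lt u)) _.
  rewrite (_ : rowU u = mkseq (fun j => Defs.mem cf (regs cf 2 + enum_rank u * w + j)) w) //.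
  apply/eq_in_map => j; rewrite mem_iota => /andP[_ jw].
  have un : enum_rank u < n by apply: ltn_ord.
  have w0 : 0 < w by rewrite muln_gt0 muln_gt0 e0 L0 addn3.
  rewrite -addnA hmem; last first.
    apply: (@leq_trans ((enum_rank u).+1 * w)); first by rewrite mulSn; lia.
    by rewrite leq_mul2r un orbT.
  by rewrite divnMDl // divn_small // addn0 modnMDl modn_small.
- split=> [u|i u uS]; first by rewrite card_enum_seq // size_mkseq.
  pose s := l i; have iz := ltn_ord i.
  have es : s = ranks i by rewrite /s lE; congr ranks; apply: val_inj.
  have us : val (enum_rank u) \notin s by rewrite es mem_ranks.
  have un : enum_rank u < n by apply: ltn_ord.
  have sn : all (fun v => v < n) s by apply/allP => v; apply: l_lt.
  pose bad x := has (fun v => x \in row w Y g ps v) s.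
  have hbad : count bad (rowU u) <= L * (L + 3).
    apply: leq_trans (row_collisions g hps1 L0 n_lt un sn us) _.
    rewrite mulnC leq_mul2l; apply/orP; right.
    rewrite -(leq_exp2l (m := 2)) // expnD.
    have := load_bound l_size k0 iz (hg _ un) hpot.
    have -> : load l g i n (g (enum_rank u)) = count (fun v => g v == g (enum_rank u)) s.
      by apply: eq_in_count => v /(allP sn) ->.
    move=> h; apply: leq_trans h _.
    have hz : z * kp <= 4 * n by rewrite nE mulnCA leq_mul2l; apply/orP; right; lia.
    by rewrite -mulnA; lia.
  have -> : w = count (predC bad) (rowU u) + count bad (rowU u).
    by rewrite addnC count_predC size_mkseq.
  apply: leq_add hbad; rewrite -size_filter.
  have fu : uniq [seq x <- rowU u | predC bad x] by apply: filter_uniq.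
  have fl : all (fun x => x < ell) [seq x <- rowU u | predC bad x].
    by apply/allP => x; rewrite mem_filter => /andP[_ /(allP (row_lt u))].
  rewrite -(card_enum_seq fu fl); apply/subset_leq_card/subsetP => x.
  rewrite !inE mem_filter /= => /andP[nb ->]; rewrite andbT.
  apply/negP => /bigcupP[v vS]; rewrite inE => xv; move/negP: nb; apply.
  by apply/hasP; exists (val (enum_rank v)); rewrite // es mem_ranks.
- split=> //; rewrite /ell.
  have wle : w <= 4 * (e * L ^ 2) by apply: weight_le.
  have h1 : kp <= 4 * k by lia.
  have h3 : Y <= 17 * (e * L ^ 3).
    have E0 : 0 < e * L ^ 3 by rewrite muln_gt0 e0.
    have [/andP[_ hY2] _ _ _] := hps; apply: leq_trans hY2 _.
    by rewrite -mulnA; move: (e * L ^ 3) E0 => E E0; clear -E0; lia.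
  apply: leq_trans (leq_mul (leq_mul h1 wle) h3) _.
  rewrite [L ^ 5](expnD L 2 3) -mulnn.
  move: (L ^ 2) (L ^ 3) => a b; clear; lia.
Qed.

End Code.

Section Logarithm.

Variable R : realType.
Local Open Scope ring_scope.

Lemma lg_ge1 n : 1 <= lg R n.
Proof.
have l2 : 0 < ln (2 : R) by rewrite ln_gt0 // ltr1n.
rewrite /lg ler_pdivlMr // mul1r ler_ln ?posrE ?ltr0n ?ler_nat ?leq_maxl //.
by rewrite leq_max.
Qed.

Lemma trunc_log_lg n : (0 < n)%N -> (trunc_log 2 n).+1%:R <= 2 * lg R n.
Proof.
move=> n0; have l2 : 0 < ln (2 : R) by rewrite ln_gt0 // ltr1n.
have h : (trunc_log 2 n)%:R <= lg R n.
  rewrite /lg ler_pdivlMr // mulr_natl -lnXn // -natrX.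
  rewrite ler_ln ?posrE ?ltr0n ?expn_gt0 ?leq_max // ler_nat.
  by rewrite leq_max trunc_logP ?orbT.
by have := lg_ge1 n; rewrite -natr1; lra.
Qed.

Lemma inv_ceil_bounds (eps : R) : 0 < eps -> eps < 1 ->
  [/\ (1 < inv_ceil eps)%N, eps^-1 <= (inv_ceil eps)%:R & (inv_ceil eps)%:R <= 2 * eps^-1].
Proof.
move=> eps0 eps1; have i1 : 1 < eps^-1 by rewrite invf_gt1.
have [c1 c2] : (Num.ceil eps^-1 - 1)%:~R < eps^-1 /\ eps^-1 <= (Num.ceil eps^-1)%:~R.
  by have /andP[] := ceil_itv eps^-1.
have c0 : 0 <= Num.ceil eps^-1 by rewrite ceil_ge0; lra.
have e : (inv_ceil eps)%:R = (Num.ceil eps^-1)%:~R :> R.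
  by rewrite natr_absz ger0_norm.
rewrite e; split=> //; last by move: c1; rewrite rmorphB /=; lra.
by rewrite -(ltr_nat R) e; lra.
Qed.

End Logarithm.

Local Open Scope ring_scope.

Theorem theorem2p10 (R : realType) :
  exists (P : program) (K : R) (c : nat),
    (0 < c)%N /\
    forall (U : finType) (z k : nat) (S : 'I_z -> {set U}) (eps : R),
      (1 <= z)%N -> (1 <= k)%N -> #|U| = (z * k)%N ->
      (forall i, (#|S i| <= k)%N) ->
      0 < eps -> eps < 1 ->
    forall (L : 'I_z -> seq U),
      (forall i, uniq (L i)) -> (forall i, L i =i S i) ->
    forall W : nat,
      ((#|U| * inv_ceil eps) ^ c < 2 ^ W)%N ->
    exists (T M w ell : nat) (C : U -> {set 'I_ell}) (cf : config),
      [/\ runs_within W P (encode_input k (inv_ceil eps) L) T M cf,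
          outputs_code cf M w C,
          superimposed_code S ((1 - eps) * w%:R) w C &
          [/\ (0 < w)%N,
              w%:R <= K * (eps^-1 * lg R #|U| ^+ 2),
              ell%:R <= K * (eps^-1 ^+ 2 * k%:R * lg R #|U| ^+ 5),
              T%:R <= K * (eps^-1 * #|U|%:R * lg R #|U| ^+ 2) &
              M%:R <= K * (eps^-1 * #|U|%:R * lg R #|U| ^+ 2)]].
Proof.
exists (compile 0 construction), (10 ^+ 6), 15%N; split=> // U z k S eps z1 k1 Un Sk eps0 eps1 Ls Lu LS W hW.
have [e1 e2 e3] := inv_ceil_bounds eps0 eps1.
have [T [M [ell [C [cf [hrun hout [hC1 hC2] [hT hM hell]]]]]]] :=
  code_construction z1 k1 e1 Un Sk Lu LS hW.
have U0 : (0 < #|U|)%N by rewrite Un muln_gt0 z1.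
have L2 := trunc_log_lg R U0; have lg1 := lg_ge1 R #|U|.
move: (inv_ceil eps) (lg R #|U|) (trunc_log 2 #|U|).+1 e1 e2 e3 L2 lg1 hrun hout hC1 hC2 hT hM hell
  (ltn0Sn (trunc_log 2 #|U|)) => e lgU L e1 e2 e3 L2 lg1 hrun hout hC1 hC2 hT hM hell L0.
have w4 : (e * L * (L + 3) <= 4 * (e * L ^ 2))%N by apply: weight_le.
have i0 : 0 < eps^-1 by rewrite invr_gt0.
have el2 : e%:R * L%:R ^+ 2 <= 8 * (eps^-1 * lgU ^+ 2) :> R.
  apply: (@le_trans _ _ ((2 * eps^-1) * (2 * lgU) ^+ 2)); last by rewrite exprMn; lra.
  by apply: ler_pM; rewrite ?exprn_ge0 ?ler0n // lerXn2r ?nnegrE ?ler0n //; lra.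
have nel2 : (e * #|U| * L ^ 2)%:R <= 8 * (eps^-1 * #|U|%:R * lgU ^+ 2) :> R.
  rewrite (_ : _%:R = e%:R * L%:R ^+ 2 * #|U|%:R :> R); last by rewrite -natrX -!natrM mulnAC.
  rewrite [leRHS](_ : _ = (8 * (eps^-1 * lgU ^+ 2)) * #|U|%:R); last lra.
  by rewrite ler_wpM2r ?ler0n.
have lift a b c (x : R) : (a <= b * c)%N -> c%:R <= 8 * x -> b%:R <= 10 * 2500 :> R -> 0 <= x ->
    a%:R <= 10 ^+ 6 * x.
  rewrite -(ler_nat R) natrM => hab hc hb x0; apply: le_trans hab _.
  apply: (@le_trans _ _ (10 * 2500 * (8 * x))); last lra.
  by apply: ler_pM; rewrite ?ler0n.
have lg0 : 0 <= lgU by lra.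
have x0 : 0 <= eps^-1 * #|U|%:R * lgU ^+ 2 by rewrite !mulr_ge0 ?exprn_ge0 ?ler0n // ltW.
exists T, M, (e * L * (L + 3))%N, ell, C, cf; split=> //.
- split=> // i u uS; have := hC2 i u uS; rewrite -(ler_nat R) natrD => h.
  suff : (L * (L + 3))%:R <= eps * (e * L * (L + 3))%:R :> R by lra.
  rewrite -mulnA; move: (L * (L + 3))%N => q; rewrite natrM mulrA ler_peMl ?ler0n //.
  by rewrite -ler_pdivrMl // mulr1.
- split.
  + by rewrite !muln_gt0 L0 addn3 (ltnW e1).
  + apply: lift w4 _ _ _; rewrite 1?natrM ?natrX //; first lra.
    by rewrite mulr_ge0 ?exprn_ge0 // ltW.
  + have := hell; rewrite -(ler_nat R).
    rewrite (_ : (272 * _)%:R = 272 * (e%:R ^+ 2 * k%:R * L%:R ^+ 5) :> R); last first.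
      by rewrite -!natrX -!natrM.
    move=> h; apply: le_trans h _.
    have h2 : e%:R ^+ 2 <= 4 * eps^-1 ^+ 2 :> R.
      apply: (@le_trans _ _ ((2 * eps^-1) ^+ 2)); last by rewrite exprMn; lra.
      by rewrite lerXn2r ?nnegrE ?ler0n //; lra.
    have h5 : L%:R ^+ 5 <= 32 * lgU ^+ 5 :> R.
      apply: (@le_trans _ _ ((2 * lgU) ^+ 5)); last by rewrite exprMn; lra.
      by rewrite lerXn2r ?nnegrE ?ler0n //; lra.
    apply: (@le_trans _ _ (272 * ((4 * eps^-1 ^+ 2) * k%:R * (32 * lgU ^+ 5)))).
      rewrite ler_wpM2l // ler_pM ?mulr_ge0 ?exprn_ge0 ?ler0n //.
      by rewrite ler_wpM2r ?ler0n.
    have : 0 <= eps^-1 ^+ 2 * k%:R * lgU ^+ 5.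
      by rewrite !mulr_ge0 ?exprn_ge0 ?ler0n // ltW.
    lra.
  + apply: lift hT nel2 _ x0; rewrite natrM; lra.
  + apply: lift hM nel2 _ x0; lra.
Qed.
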